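(* Let $k\ge4$ be an integer and let $\eta\in[\eta_{k+1},\eta_k)$. Then the vertices of the polygon $\mathrm{co}(K_\eta)$ are, in clockwise order, $b_0,z_0,z_1,\dots,z_k,w_1,\dots,w_k$.
   Context: For $\eta\in(0,\pi/3)$ let $a=\frac{e^{-i\eta}}{2\cos\eta}$ (so $|a|=\frac{1}{2\cos\eta}$), $f_1(z)=az$, $f_2(z)=1-\bar a z$, and let $K_\eta$ be the unique nonempty compact set with $K_\eta=f_1(K_\eta)\cup f_2(K_\eta)$. Let $c=\frac{1}{1-|a|^4}$ and for integers $j\ge0$ put $z_j=ca^{j+1}$, $w_j=1-c|a|^2a^j$, $b_j=a+c|a|^4a^j$. For integers $k\ge 1$ define $\Phi_k(\eta)=(1-|a|^4)\sin((k-1)\eta)-|a|^3\sin((k-2)\eta)+|a|^k\sin\eta$ (with $|a|=1/(2\cos\eta)$). For each integer $k\ge4$, $\Phi_k$ has a unique zero in the interval $(\pi/k,\pi/(k-1))$, denoted $\eta_k$. *)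

(* Defs.v *)
(* The complex plane is modelled as R * R
   (real part, imaginary part), with the product topology. *)
From HB Require Import structures.
From mathcomp Require Import all_boot all_order all_algebra.
From mathcomp Require Import all_classical all_reals all_analysis.
Set Implicit Arguments. Unset Strict Implicit. Unset Printing Implicit Defensive.
Import Order.TTheory GRing.Theory Num.Theory.
Import numFieldNormedType.Exports.
Local Open Scope classical_set_scope.
Local Open Scope ring_scope.

Section Defs.
Variable R : realType.
Notation pt := (R * R)%type.

Definition cadd (z w : pt) : pt := (z.1 + w.1, z.2 + w.2).
Definition csub (z w : pt) : pt := (z.1 - w.1, z.2 - w.2).
Definition cmul (z w : pt) : pt := (z.1 * w.1 - z.2 * w.2, z.1 * w.2 + z.2 * w.1).
Definition cconj (z : pt) : pt := (z.1, - z.2).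
Definition creal (x : R) : pt := (x, 0).
Fixpoint cpow (z : pt) (n : nat) : pt :=
  if n is m.+1 then cmul z (cpow z m) else creal 1.

Definition absa (eta : R) : R := 1 / (2 * cos eta).
(* a = e^{-i eta} / (2 cos eta) *)
Definition a_of (eta : R) : pt := (cos eta * absa eta, - sin eta * absa eta).
Definition f1 (eta : R) (z : pt) : pt := cmul (a_of eta) z.
Definition f2 (eta : R) (z : pt) : pt := csub (creal 1) (cmul (cconj (a_of eta)) z).

Definition c_of (eta : R) : R := 1 / (1 - absa eta ^+ 4).
Definition zj (eta : R) (j : nat) : pt := cmul (creal (c_of eta)) (cpow (a_of eta) j.+1).
Definition wj (eta : R) (j : nat) : pt :=
  csub (creal 1) (cmul (creal (c_of eta * absa eta ^+ 2)) (cpow (a_of eta) j)).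
Definition bj (eta : R) (j : nat) : pt :=
  cadd (a_of eta) (cmul (creal (c_of eta * absa eta ^+ 4)) (cpow (a_of eta) j)).

Definition Phi (k : nat) (eta : R) : R :=
  (1 - absa eta ^+ 4) * sin ((k%:R - 1) * eta)
  - absa eta ^+ 3 * sin ((k%:R - 2) * eta)
  + absa eta ^+ k * sin eta.

Definition segpt (t : R) (x y : pt) : pt :=
  (t * x.1 + (1 - t) * y.1, t * x.2 + (1 - t) * y.2).
Definition convex_pt (C : set pt) : Prop :=
  forall x y t, C x -> C y -> 0 <= t <= 1 -> C (segpt t x y).
Definition conv_hull (A : set pt) : set pt :=
  \bigcap_(C in [set C | convex_pt C /\ A `<=` C]) C.
Definition extreme_pt (S : set pt) (x : pt) : Prop :=
  S x /\ forall y z t, S y -> S z -> 0 < t < 1 -> x = segpt t y z -> y = z.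

Definition cross (o p q : pt) : R :=
  (p.1 - o.1) * (q.2 - o.2) - (p.2 - o.2) * (q.1 - o.1).

(* [polygon_cw S ps]: S is a (convex) polygon whose vertices are exactly
   the points of ps, listed in clockwise order: for each (cyclic) edge
   p_i -> p_{i+1}, every other listed vertex lies strictly to its right. *)
Definition polygon_cw (S : set pt) (ps : seq pt) : Prop :=
  let n := size ps in
  let p i := nth (0, 0) ps i in
  [/\ (3 <= n)%N,
      S = conv_hull [set x | x \in ps],
      extreme_pt S = [set x | x \in ps] &
      forall i j, (i < n)%N -> (j < n)%N -> j != i -> j != (i.+1 %% n)%N ->
        cross (p i) (p (i.+1 %% n)%N) (p j) < 0].

Definition vertex_list (eta : R) (k : nat) : seq pt :=
  bj eta 0 :: [seq zj eta j | j <- iota 0 k.+1] ++ [seq wj eta j | j <- iota 1 k].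

End Defs.

(* Main.v *)
(** The functional [height t z = Im (e^{it} z)] turns the two maps into shifts
    of the angle: [height t (f1 z) = |a| height (t - eta) z] and
    [height t (f2 z) = sin t + |a| height (t + eta + pi) z].

    The edges z_0 z_1, ..., z_(k-1) z_k of the announced polygon are the
    images of the first one under f1 and have the clockwise angles
    pi + j eta.  Let beta be the angle of the edge from z_k to w_1.  Since
    w_j = f2 z_j, f2 w_1 = b_0 and f2 w_2 = z_0, all remaining edges are images
    under f2 of edges already found, with angles raised by pi - eta.  The signs
    of Phi_k and Phi_(k+1) at eta say exactly that
    pi + (k - 1) eta < beta <= pi + k eta.  So the edge angles increase, with
    total turn 2 pi, and the polygon is the intersection of the half-planes of
    its edges.

    To see that f1 and f2 map the polygon into itself, shift the angle of each
    edge by - eta or by eta + pi, find the vertex whose normal cone contains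
    the result, and check that its image satisfies the inequality of the edge.
    As f1 and f2 contract, the polygon contains K.  Conversely z_0 is the
    fixed point of f2 f2 f1 f1 and every other vertex is an image of z_0, so
    all of them lie in K. *)

From mathcomp Require Import all_boot all_order all_algebra.
From mathcomp Require Import all_classical all_reals all_analysis.
From mathcomp Require Import zify ring lra.
Require Import Defs.
Set Implicit Arguments. Unset Strict Implicit. Unset Printing Implicit Defensive.
Import Order.TTheory GRing.Theory Num.Theory.
Import numFieldNormedType.Exports.
Local Open Scope classical_set_scope.
Local Open Scope ring_scope.

(** * Heights and directed edges *)

Section Heights.
Context {R : realType}.
Local Notation pt := (R * R)%type.
Implicit Types (t u v s rho : R) (x y z : pt).

Lemma sin_lt0_Npi t : - pi < t < 0 -> sin t < 0.
Proof. by move=> ht; rewrite -oppr_gt0 -sinN; apply: sin_gt0_pi; lra. Qed.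

Lemma sin_le0_Npi t : - pi <= t <= 0 -> sin t <= 0.
Proof. by move=> ht; rewrite -oppr_ge0 -sinN; apply: sin_ge0_pi; lra. Qed.

Lemma sin_piB t : sin (pi - t) = sin t.
Proof. by rewrite sinB sinpi cospi; ring. Qed.

(* The point rho e^{-it}: angles are measured clockwise. *)
Definition polar rho t : pt := (rho * cos t, - (rho * sin t)).

(* Im (e^{it} z): constant along a clockwise edge of direction e^{-it}, and
   smaller inside the polygon. *)
Definition height t z : R := sin t * z.1 + cos t * z.2.

Lemma heightD t x y : height t (x + y) = height t x + height t y.
Proof. by rewrite /height /=; ring. Qed.

Lemma heightB t x y : height t (x - y) = height t x - height t y.
Proof. by rewrite /height /=; ring. Qed.

Lemma heightZ t s x : height t (s *: x) = s * height t x.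
Proof. by rewrite /height /= /GRing.scale /=; ring. Qed.

Lemma height_segpt t s x y :
  height t (segpt s x y) = s * height t x + (1 - s) * height t y.
Proof. by rewrite /height /=; ring. Qed.

Lemma height_polar t rho u : height t (polar rho u) = rho * sin (t - u).
Proof. by rewrite /height /= sinB; ring. Qed.

Lemma heightDpi t z : height (t + pi) z = - height t z.
Proof. by rewrite /height sinDpi cosDpi; ring. Qed.

Lemma heightD2pi t z : height (t + pi *+ 2) z = height t z.
Proof. by rewrite /height sinD2pi cosD2pi. Qed.

Lemma continuous_height z : continuous (height ^~ z).
Proof.
move=> t; apply: cvgD; apply: cvgM; [exact: continuous_sin|exact: cvg_cst
  |exact: continuous_cos|exact: cvg_cst].
Qed.

Lemma height_le_norm t z : height t z <= 2 * `|z|.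
Proof.
have := lexx `|z|; rewrite {1}/Num.norm /= ge_max => /andP[z1 z2].
have coef_le (s x : R) : `|s| <= 1 -> s * x <= `|x|.
  by move=> s1; apply: le_trans (ler_norm _) _; rewrite normrM ler_piMl.
have := coef_le _ z.1 (sin_max t); have := coef_le _ z.2 (cos_max t).
by rewrite /height; lra.
Qed.

Lemma height_cone t u v z :
  sin (v - u) * height t z = sin (v - t) * height u z + sin (t - u) * height v z.
Proof. by rewrite /height !sinB; ring. Qed.

Lemma height_inj2 t u x y : sin (u - t) != 0 ->
  height t x = height t y -> height u x = height u y -> x = y.
Proof.
move=> tu0 eq_t eq_u.
have eq_height s : height s x = height s y.
  by apply: (mulfI tu0); rewrite !(height_cone s t u) eq_t eq_u.
move: (eq_height 0) (eq_height (pi / 2)).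
rewrite /height sin0 cos0 sin_pihalf cos_pihalf.
by case: x y {eq_t eq_u eq_height} => ? ? [? ?] /= ? ?; congr (_, _); lra.
Qed.

Lemma height_inj x y : (forall t, height t x = height t y) -> x = y.
Proof.
move=> eq_height; apply: (@height_inj2 0 (pi / 2)) => //.
by rewrite subr0 sin_pihalf oner_neq0.
Qed.

Lemma height_eq0_polar t z : height t z = 0 -> z = polar (height (t + pi / 2) z) t.
Proof.
move=> z0; apply: height_inj => s; rewrite height_polar.
have := height_cone s t (t + pi / 2) z.
by rewrite addrAC subrr add0r sin_pihalf z0 mul1r mulr0 add0r mulrC.
Qed.

Definition directed t x y : Prop := exists2 rho, 0 < rho & y = x + polar rho t.

Lemma directedD2pi t x y : directed (t + pi *+ 2) x y <-> directed t x y.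
Proof. by rewrite /directed /polar sinD2pi cosD2pi. Qed.

Lemma directed_height t x y : directed t x y -> height t x = height t y.
Proof. by case=> rho _ ->; rewrite heightD height_polar subrr sin0 mulr0 addr0. Qed.

Lemma directed_height_lt t u x y :
  directed u x y -> t < u < t + pi -> height t y < height t x.
Proof.
case=> rho rho0 -> htu; rewrite heightD height_polar gtrDl pmulr_rlt0 //.
by apply: sin_lt0_Npi; lra.
Qed.

Lemma directed_height_le t u x y :
  directed u x y -> t <= u <= t + pi -> height t y <= height t x.
Proof.
case=> rho rho0 -> htu; rewrite heightD height_polar gerDl pmulr_rle0 //.
by apply: sin_le0_Npi; lra.
Qed.

Lemma directed_angle_le s t x y : directed s x y ->
  s < t + pi -> height t x <= height t y -> s <= t.
Proof.
move=> xy st; rewrite !leNgt; apply: contraNN => ts.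
by apply: directed_height_lt xy _; rewrite ts.
Qed.

Lemma directed_angle_ge s t x y : directed s x y ->
  t < s + pi -> height t y <= height t x -> t <= s.
Proof.
move=> xy ts; rewrite -(subrK pi t) !heightDpi lerN2 !leNgt; apply: contraNN => st.
by apply: directed_height_lt xy _; lra.
Qed.

Lemma directed_ivt t u x y : t < u < t + pi ->
  height t y < height t x -> height u x < height u y ->
  exists2 s, t < s < u & directed s x y.
Proof.
move=> tu ht hu; pose d := y - x.
have dt : height t d < 0 by rewrite heightB subr_lt0.
have du : 0 < height u d by rewrite heightB subr_gt0.
have cont : {within `[t, u], continuous (height ^~ d)}.
  by apply: continuous_subspaceT => s; exact: continuous_height.
have [s] : exists2 s, s \in `[t, u] & height s d = 0.
  by apply: IVT => //; rewrite ?ge_min ?le_max ?(ltW dt) ?(ltW du) ?orbT //; lra.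
rewrite in_itv /= !le_eqVlt => /andP[/predU1P[ts|ts] + ds].
  by move: dt; rewrite ts ds ltxx.
move=> /predU1P[su|su]; first by move: du; rewrite -su ds ltxx.
exists s; first by rewrite ts.
have dE := height_eq0_polar ds; exists (height (s + pi / 2) d).
  have sin_ts : sin (t - s) < 0 by apply: sin_lt0_Npi; lra.
  by rewrite -(nmulr_llt0 _ sin_ts) -height_polar -dE.
by rewrite -dE addrC subrK.
Qed.

Lemma directed_cross t x y z : directed t x y ->
  exists2 rho, 0 < rho & cross x y z = rho * (height t z - height t x).
Proof.
by case=> rho rho0 ->; exists rho => //; rewrite /cross /height /=; ring.
Qed.

Lemma directed_cross_lt0 t x y z :
  directed t x y -> (cross x y z < 0) = (height t z < height t x).
Proof.
by move/directed_cross=> /(_ z) [rho rho0 ->]; rewrite pmulr_rlt0 // subr_lt0.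
Qed.

Lemma directed_cross_le0 t x y z :
  directed t x y -> (cross x y z <= 0) = (height t z <= height t x).
Proof.
by move/directed_cross=> /(_ z) [rho rho0 ->]; rewrite pmulr_rle0 // subr_le0.
Qed.

Definition supports (P : set pt) t x : Prop :=
  forall z, P z -> height t z <= height t x.

Lemma supportsD2pi (P : set pt) t x : supports P (t + pi *+ 2) x <-> supports P t x.
Proof. by split=> Px z /Px; rewrite !heightD2pi. Qed.

Lemma supports_cone (P : set pt) u t v x : 0 < v - u < pi -> u <= t <= v ->
  supports P u x -> supports P v x -> supports P t x.
Proof.
move=> uv ut Pu Pv z Pz.
have uv0 : 0 < sin (v - u) by apply: sin_gt0_pi; lra.
rewrite -(ler_pM2l uv0) !(height_cone t u v).
by apply: lerD; apply: ler_wpM2l; [apply: sin_ge0_pi; lra|exact: Pu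
  |apply: sin_ge0_pi; lra|exact: Pv].
Qed.

End Heights.

(** * Convex hulls in the plane *)

Section ConvexHull.
Context {R : realType}.
Local Notation pt := (R * R)%type.
Implicit Types (A C : set pt) (a b c x y z : pt).

Lemma segptE t x y : segpt t x y = t *: x + (1 - t) *: y.
Proof. by []. Qed.

Lemma segpt0 x y : segpt 0 x y = y.
Proof. by rewrite segptE scale0r add0r subr0 scale1r. Qed.

Lemma segpt1 x y : segpt 1 x y = x.
Proof. by rewrite segptE subrr scale0r addr0 scale1r. Qed.

Lemma segptxx t x : segpt t x x = x.
Proof. by rewrite segptE -scalerDl addrC subrK scale1r. Qed.

Lemma conv_hull_convex A : convex_pt (conv_hull A).
Proof.
move=> x y t Ax Ay t01 C AC; have [convC _] := AC.
by apply: convC => //; [exact: Ax|exact: Ay].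
Qed.

Lemma sub_conv_hull A : A `<=` conv_hull A.
Proof. by move=> x Ax C [_]; apply. Qed.

Lemma conv_hull_sub A C : convex_pt C -> A `<=` C -> conv_hull A `<=` C.
Proof. by move=> convC AC x; apply. Qed.

Lemma extreme_conv_hull A : extreme_pt (conv_hull A) `<=` A.
Proof.
move=> x [hx x_extr]; apply: contrapT => nAx.
suff : (conv_hull A `\ x) x by case=> _; apply.
apply: (hx (conv_hull A `\ x)); split; last first.
  by move=> y Ay; split; [exact: sub_conv_hull|move=> yx; apply: nAx; rewrite -yx].
move=> y z t [hy yx] [hz zx] t01; split; first exact: conv_hull_convex.
move=> /= x_segpt; have [t0|t0] := eqVneq t 0.
  by apply: zx; rewrite -x_segpt t0 segpt0.
have [t1|t1] := eqVneq t 1; first by apply: yx; rewrite -x_segpt t1 segpt1.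
have yz : y = z by apply: (x_extr _ _ t) => //; rewrite !lt_neqAle eq_sym t0 t1.
by apply: yx; rewrite -x_segpt -yz segptxx.
Qed.

Lemma convex_pt_barycenter C a b c (k l m : R) : convex_pt C -> C a -> C b -> C c ->
  0 <= k -> 0 <= l -> 0 <= m -> k + l + m = 1 -> C (k *: a + l *: b + m *: c).
Proof.
move=> convC Ca Cb Cc k0 l0 m0 klm1.
have [k1|k1] := leP 1 k.
  have [-> -> ->] : [/\ k = 1, l = 0 & m = 0] by split; lra.
  by rewrite !scale0r !addr0 scale1r.
have k1_neq0 : 1 - k != 0 by rewrite subr_eq0 gt_eqF.
have -> : k *: a + l *: b + m *: c = segpt k a (segpt (l / (1 - k)) b c).
  rewrite !segptE scalerDr !scalerA addrA mulrBr mulr1 mulrCA divff // mulr1.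
  by congr (_ + _ *: _); lra.
apply: (convC) => //; last by rewrite k0 ltW.
apply: (convC) => //.
by rewrite divr_ge0 ?ler_pdivrMr ?mul1r ?subr_ge0 ?subr_gt0 //; lra.
Qed.

Lemma convex_pt_triangle C a b c z : convex_pt C -> C a -> C b -> C c ->
  cross a b c < 0 -> cross a b z <= 0 -> cross b c z <= 0 -> cross c a z <= 0 -> C z.
Proof.
move=> convC Ca Cb Cc abc_lt0 abz bcz caz; set D := cross a b c in abc_lt0.
have D0 : D != 0 by rewrite lt_eqF.
have bary : z =
    (cross b c z / D) *: a + (cross c a z / D) *: b + (cross a b z / D) *: c.
  rewrite [LHS]surjective_pairing [RHS]surjective_pairing /=.
  have cancelD (s t : R) : s / D * t * D = s * t by rewrite mulrAC divfK.
  by congr (_, _); apply: (mulIf D0);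
    rewrite /GRing.scale /= !mulrDl !cancelD /D /cross; ring.
rewrite bary; apply: convex_pt_barycenter => //; rewrite ?ler_ndivlMr ?mul0r //.
by rewrite -!mulrDl; apply: (mulIf D0); rewrite divfK // mul1r /D /cross; ring.
Qed.

End ConvexHull.

(** * Clockwise polygons *)

Lemma discrete_ivt (R : realDomainType) (f : nat -> R) a b :
  (a < b)%N -> f a <= 0 -> 0 <= f b ->
  exists2 i, (a <= i < b)%N & f i <= 0 <= f i.+1.
Proof.
elim: b => // b IH; rewrite ltnS => ab fa fb.
have [fb0|fb0] := leP (f b) 0; first by exists b; rewrite ?ab ?ltnSn ?fb0.
move: ab; rewrite leq_eqVlt => /predU1P[ab|ab].
  by move: fb0; rewrite -ab ltNge fa.
by have [i ?] := IH ab fa (ltW fb0); exists i => //; lia.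
Qed.

Section Clockwise.
Context {R : realType}.
Local Notation pt := (R * R)%type.

(* The last clause forces the edges to turn by 2 pi in total, so that the
   polygon winds only once. *)
Record clockwise (ps : seq pt) (theta : nat -> R) : Prop := Clockwise {
  clockwise_size : (2 < size ps)%N;
  clockwise_edge i : (i < size ps)%N ->
    directed (theta i) (nth (0, 0) ps i) (nth (0, 0) ps (i.+1 %% size ps));
  clockwise_turn i : (i.+1 < size ps)%N -> theta i < theta i.+1 < theta i + pi;
  clockwise_wrap :
    theta (size ps).-1 < theta 0 + pi *+ 2 < theta (size ps).-1 + pi
}.

Definition halfplanes (ps : seq pt) (theta : nat -> R) : set pt :=
  [set z | forall i, (i < size ps)%N ->
    height (theta i) z <= height (theta i) (nth (0, 0) ps i)].

Lemma halfplanes_convex ps theta : convex_pt (halfplanes ps theta).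
Proof.
move=> x y t Px Py /andP[t0 t1] i i_lt; rewrite height_segpt.
have := Px i i_lt; have := Py i i_lt; nra.
Qed.

Variables (ps : seq pt) (theta : nat -> R).
Hypothesis cw : clockwise ps theta.
Local Notation n := (size ps).
Local Notation p i := (nth (0, 0) ps i).
Local Notation P := (halfplanes ps theta).

Let cyc_p m := p (m %% n).
Let cyc_theta m := theta (m %% n) + pi *+ 2 *+ (m %/ n).

Let n_gt0 : (0 < n)%N. Proof. exact: leq_trans (clockwise_size cw). Qed.

Let cyc_p_period m : cyc_p (m + n) = cyc_p m.
Proof. by rewrite /cyc_p modnDr. Qed.

Let cyc_p_small i : (i < n)%N -> cyc_p i = p i.
Proof. by move=> i_lt; rewrite /cyc_p modn_small. Qed.

Let cyc_theta_period m : cyc_theta (m + n) = cyc_theta m + pi *+ 2.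
Proof.
by rewrite /cyc_theta modnDr divnDr ?dvdnn // divnn n_gt0 addn1 mulrSr addrA.
Qed.

Let cyc_theta_small i : (i < n)%N -> cyc_theta i = theta i.
Proof. by move=> i_lt; rewrite /cyc_theta modn_small // divn_small // mulr0n addr0. Qed.

Let height_cyc_theta m z : height (cyc_theta m) z = height (theta (m %% n)) z.
Proof.
by rewrite /height /cyc_theta (periodicn (@sinD2pi R)) (periodicn (@cosD2pi R)).
Qed.

Let cyc_p_edge m : directed (cyc_theta m) (cyc_p m) (cyc_p m.+1).
Proof.
have := clockwise_edge cw (ltn_pmod m n_gt0).
rewrite /directed /polar /cyc_theta (periodicn (@sinD2pi R)) (periodicn (@cosD2pi R)).
by rewrite -addn1 modnDml addn1.
Qed.

Let cyc_theta_turn m : cyc_theta m < cyc_theta m.+1 < cyc_theta m + pi.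
Proof.
elim/ltn_ind: m => m IH; have [m_lt|n_le] := ltnP m n; last first.
  rewrite -(subnK n_le) -addSn !cyc_theta_period.
  by have := IH (m - n)%N ltac:(lia); lra.
rewrite (cyc_theta_small m_lt); have [m1_lt|n_le] := ltnP m.+1 n.
  by rewrite cyc_theta_small //; exact: (clockwise_turn cw).
have -> : m = n.-1 by move: m_lt n_le; clear; lia.
rewrite prednK // -[n in cyc_theta n]add0n cyc_theta_period (cyc_theta_small n_gt0).
exact: (clockwise_wrap cw).
Qed.

Let cyc_theta_lt : {homo cyc_theta : i j / (i < j)%N >-> i < j}.
Proof.
by apply: homo_ltn => [y x z|m]; [exact: lt_trans|case/andP: (cyc_theta_turn m)].
Qed.

Let cyc_theta_le i j : (i <= j)%N -> cyc_theta i <= cyc_theta j.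
Proof. by rewrite leq_eqVlt => /predU1P[->//|/cyc_theta_lt/ltW]. Qed.

Let descent t i j : (i < j)%N -> t < cyc_theta i -> cyc_theta j.-1 < t + pi ->
  height t (cyc_p j) < height t (cyc_p i).
Proof.
elim: j => // j IH; rewrite ltnS leq_eqVlt => /predU1P[<-|ij] t_i j_t /=.
  by apply: directed_height_lt (cyc_p_edge i) _; rewrite t_i.
have := cyc_theta_lt ij; have := cyc_theta_le (leq_pred j).
move: j_t => /= j_t ? ?; apply: (@lt_trans _ _ (height t (cyc_p j))).
  by apply: directed_height_lt (cyc_p_edge j) _; lra.
by apply: IH => //; lra.
Qed.

(* With respect to the direction of an edge, the vertices go down as long as
   the edges have turned by less than pi, and go up afterwards. *)
Let strictly_right i j : (i.+1 < j)%N -> (j < i + n)%N ->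
  height (cyc_theta i) (cyc_p j) < height (cyc_theta i) (cyc_p i).
Proof.
move=> ij jn; have [j_lt|j_ge] := ltP (cyc_theta j.-1) (cyc_theta i + pi).
  rewrite (directed_height (cyc_p_edge i)); apply: descent => //.
  by case/andP: (cyc_theta_turn i).
rewrite -(cyc_p_period i) -ltrN2 -!heightDpi; apply: descent => //.
  by apply: le_lt_trans j_ge _; apply: cyc_theta_lt; lia.
by rewrite -addrA -mulr2n -cyc_theta_period; apply: cyc_theta_lt; lia.
Qed.

Lemma clockwise_height_lt i j :
  (i < n)%N -> (j < n)%N -> j != i -> j != (i.+1 %% n)%N ->
  height (theta i) (p j) < height (theta i) (p i).
Proof.
move=> i_lt j_lt ji ji1.
rewrite -(cyc_theta_small i_lt) -(cyc_p_small i_lt) -(cyc_p_small j_lt).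
have [in1|in1] := eqVneq i.+1 n; last rewrite modn_small in ji1; last by lia.
  rewrite -(cyc_p_period j); apply: strictly_right; last by lia.
  by move: ji1; rewrite in1 modnn; lia.
have [ij|ij] := ltnP i j; first by apply: strictly_right; lia.
by rewrite -(cyc_p_period j); apply: strictly_right; lia.
Qed.

Lemma halfplanes_vertex i : (i < n)%N -> P (p i).
Proof.
move=> i_lt j j_lt; have [->//|ij] := eqVneq i j.
have [->|ij1] := eqVneq i (j.+1 %% n)%N; last exact/ltW/clockwise_height_lt.
by rewrite (directed_height (clockwise_edge cw j_lt)).
Qed.

Lemma halfplanes_supports i : (i < n)%N -> supports P (theta i) (p i).
Proof. by move=> i_lt z; apply. Qed.

Let supports_fst m : supports P (cyc_theta m) (cyc_p m).
Proof. by move=> z Pz; rewrite !height_cyc_theta; apply: Pz; exact: ltn_pmod. Qed.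

Let supports_snd m : supports P (cyc_theta m) (cyc_p m.+1).
Proof.
by move=> z Pz; rewrite -(directed_height (cyc_p_edge m)); exact: supports_fst.
Qed.

Let supports_between m t :
  cyc_theta m <= t <= cyc_theta m.+1 -> supports P t (cyc_p m.+1).
Proof.
move=> ht; apply: supports_cone ht (supports_snd m) (supports_fst m.+1).
by have := cyc_theta_turn m; lra.
Qed.

Lemma clockwise_supports i t : (i.+1 < n)%N ->
  theta i <= t <= theta i.+1 -> supports P t (p i.+1).
Proof.
move=> i_lt; rewrite -(cyc_p_small i_lt) -(cyc_theta_small i_lt).
rewrite -(cyc_theta_small (ltnW i_lt)).
exact: supports_between.
Qed.

Lemma clockwise_supports_wrap t :
  theta n.-1 <= t <= theta 0 + pi *+ 2 -> supports P t (p 0).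
Proof.
move=> ht; have <- : cyc_p n.-1.+1 = p 0.
  by rewrite prednK // -[n in cyc_p n]add0n cyc_p_period cyc_p_small.
have n1_lt : (n.-1 < n)%N by rewrite prednK.
apply: supports_between; rewrite (cyc_theta_small n1_lt).
by rewrite prednK // -[n in cyc_theta n]add0n cyc_theta_period (cyc_theta_small n_gt0).
Qed.

Lemma halfplanes_extreme i : (i < n)%N -> extreme_pt P (p i).
Proof.
move=> i_lt; split; first exact: halfplanes_vertex.
move=> y z t Py Pz /andP[t0 t1] p_segpt.
have tight s : supports P s (p i) -> height s y = height s z.
  move=> Ps; have := Ps y Py; have := Ps z Pz; rewrite p_segpt height_segpt => ? ?.
  by apply/eqP; rewrite eq_le; apply/andP; split; nra.
have [m m_vertex] : exists m, cyc_p m.+1 = p i.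
  exists (i + n).-1; rewrite prednK ?cyc_p_period ?cyc_p_small //.
  by rewrite addn_gt0 n_gt0 orbT.
apply: (@height_inj2 _ (cyc_theta m) (cyc_theta m.+1)).
- by rewrite gt_eqF //; apply: sin_gt0_pi; have := cyc_theta_turn m; lra.
- by apply: tight; rewrite -m_vertex; exact: supports_snd.
- by apply: tight; rewrite -m_vertex; exact: supports_fst.
Qed.

(* A point of the half-planes lies in a triangle of the fan with apex [p 0]. *)
Lemma halfplanes_sub_conv_hull : P `<=` conv_hull [set x | x \in ps].
Proof.
move=> z Pz; have n3 := clockwise_size cw.
have hull i : (i < n)%N -> conv_hull [set x | x \in ps] (p i).
  by move=> i_lt; apply: sub_conv_hull; exact: mem_nth.
have right_of_edge i : (i < n)%N -> cross (p i) (p (i.+1 %% n)) z <= 0.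
  by move=> i_lt; rewrite (directed_cross_le0 _ (clockwise_edge cw i_lt)); exact: Pz.
have crossC x y : cross x y z = - cross y x z by rewrite /cross; ring.
have [i /andP[i0 i_lt] /andP[cross_i cross_i1]] :
    exists2 i, (1 <= i < n.-1)%N & cross (p 0) (p i) z <= 0 <= cross (p 0) (p i.+1) z.
  apply: discrete_ivt; first by lia.
    by have := right_of_edge 0 n_gt0; rewrite modn_small // ltnW.
  have := right_of_edge n.-1; rewrite prednK // modnn crossC oppr_le0; exact.
have i1_lt : (i.+1 < n)%N by lia.
apply: (@convex_pt_triangle _ _ (p i) (p i.+1) (p 0)).
- exact: conv_hull_convex.
- by apply: hull; lia.
- exact: hull.
- exact: hull.
- rewrite -(modn_small i1_lt) (directed_cross_lt0 _ (clockwise_edge cw (ltnW i1_lt))).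
  by apply: clockwise_height_lt; rewrite ?modn_small //; lia.
- by have := right_of_edge i (ltnW i1_lt); rewrite modn_small.
- by rewrite crossC oppr_le0.
- exact: cross_i.
Qed.

Lemma halfplanes_conv_hull : P = conv_hull [set x | x \in ps].
Proof.
apply/seteqP; split; first exact: halfplanes_sub_conv_hull.
apply: conv_hull_sub; first exact: halfplanes_convex.
by move=> x /(nthP (0, 0))[i i_lt <-]; exact: halfplanes_vertex.
Qed.

Lemma clockwise_polygon : polygon_cw P ps.
Proof.
split=> [||| i j i_lt j_lt ji ji1].
- exact: clockwise_size cw.
- exact: halfplanes_conv_hull.
- apply/seteqP; split; first by rewrite halfplanes_conv_hull; exact: extreme_conv_hull.
  by move=> x /(nthP (0, 0))[i i_lt <-]; exact: halfplanes_extreme.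
- rewrite (directed_cross_lt0 _ (clockwise_edge cw i_lt)).
  exact: clockwise_height_lt.
Qed.

End Clockwise.

(** * Signs of Phi *)

Section Sine.
Context {R : realType}.
Implicit Types x y : R.

Lemma ler_sin_pihalf x y : - (pi / 2) <= x -> x <= y -> y <= pi / 2 -> sin x <= sin y.
Proof. by move=> x_ge xy y_le; rewrite leNgt ltr_sin ?in_itv /= -?leNgt; lra. Qed.

Lemma ger_sin_pihalf x y :
  pi / 2 <= x -> x <= y -> y <= pi / 2 + pi -> sin y <= sin x.
Proof. by move=> x_ge xy y_le; rewrite -sin_piB -(sin_piB x) ler_sin_pihalf; lra. Qed.

Lemma ler_sinD x y : 0 <= sin x -> 0 <= sin y -> sin (x + y) <= sin x + sin y.
Proof. by move=> sx sy; rewrite sinD; have := cos_le1 x; have := cos_le1 y; nra. Qed.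

Lemma cos_sqr_ge x : - (pi / 4) <= x <= pi / 4 -> 1 / 2 <= cos x ^+ 2.
Proof.
move=> x_bd; have : 0 <= cos (x *+ 2) by apply: cos_ge0_pihalf; lra.
by rewrite cos_mulr2n; lra.
Qed.

Lemma cos_pi3 : cos (pi / 3) = 1 / 2 :> R.
Proof.
have pi0 := pi_gt0 R; have s0 : 0 < sin (pi / 3 : R) by apply: sin_gt0_pi; lra.
apply: (mulIf (lt0r_neq0 s0)); rewrite -[in RHS]sin_piB.
have -> : pi - pi / 3 = (pi / 3) *+ 2 :> R by field.
by rewrite sin_mulr2n; field.
Qed.

End Sine.

Section Modulus.
Context {R : realType}.
Variable eta : R.
Hypothesis eta_bd : 0 < eta < pi / 3.
Local Notation r := (absa eta).

Lemma sin_eta_gt0 : 0 < sin eta.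
Proof. by apply: sin_gt0_pi; have := eta_bd; lra. Qed.

Lemma cos_eta_gt : 1 / 2 < cos eta.
Proof.
by rewrite -cos_pi3 ltr_cos ?in_itv /=; have := eta_bd; lra.
Qed.

Lemma absa_cos : 2 * r * cos eta = 1.
Proof. by rewrite /absa; field; rewrite gt_eqF //; have := cos_eta_gt; lra. Qed.

Lemma absa_gt0 : 0 < r.
Proof. by have := cos_eta_gt; have := absa_cos; nra. Qed.

Lemma absa_lt1 : r < 1.
Proof. by have := cos_eta_gt; have := absa_cos; nra. Qed.

Lemma absaX_gt0 n : 0 < r ^+ n.
Proof. by rewrite exprn_gt0 // absa_gt0. Qed.

Lemma absaX_lt1 n : r ^+ n.+1 < 1.
Proof. by rewrite exprn_ilt1 // ?absa_lt1 // ltW // absa_gt0. Qed.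

Lemma ler_absaX m n : (m <= n)%N -> r ^+ n <= r ^+ m.
Proof. by move=> mn; rewrite ler_wiXn2l // ltW // ?absa_gt0 // absa_lt1. Qed.

Lemma absa_sqr_le : eta <= pi / 4 -> r ^+ 2 <= 1 / 2.
Proof.
move=> eta_le; have : 1 / 2 <= cos eta ^+ 2.
  by apply: cos_sqr_ge; have := eta_bd; lra.
have : (2 * r * cos eta) ^+ 2 = 1 by rewrite absa_cos expr1n.
by nra.
Qed.

Lemma absa4_le : eta <= pi / 4 -> r ^+ 4 <= 1 / 4.
Proof. by move/absa_sqr_le; rewrite (exprM _ 2 2); nra. Qed.

Lemma absa_sinDB x : r * (sin (x + eta) + sin (x - eta)) = sin x.
Proof. by rewrite sinD sinB -[RHS]mul1r -absa_cos; ring. Qed.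

Lemma absaX_sinM_rec n : r ^+ n.+2 * sin (n.+3%:R * eta) =
  r ^+ n.+1 * sin (n.+2%:R * eta) - r ^+ 2 * (r ^+ n * sin (n.+1%:R * eta)).
Proof.
rewrite -(absa_sinDB (n.+2%:R * eta)).
have -> : n.+2%:R * eta + eta = n.+3%:R * eta by rewrite -(natr1 n.+2); ring.
have -> : n.+2%:R * eta - eta = n.+1%:R * eta by rewrite -(natr1 n.+1); ring.
by rewrite !exprS; ring.
Qed.

Lemma absa_sin2 : r * sin (2 * eta) = sin eta.
Proof.
by rewrite -[RHS]absa_sinDB subrr sin0 addr0; congr (_ * sin _); ring.
Qed.

Lemma absa_sin3 : r ^+ 2 * sin (3 * eta) = sin eta * (1 - r ^+ 2).
Proof. by rewrite (absaX_sinM_rec 0) expr1 absa_sin2 expr0 !mul1r; ring. Qed.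

Lemma absa_sin5 : r ^+ 4 * sin (5 * eta) = sin eta * (1 - 3 * r ^+ 2 + r ^+ 4).
Proof.
by rewrite (absaX_sinM_rec 2) (absaX_sinM_rec 1) expr1 absa_sin2 absa_sin3; ring.
Qed.

Lemma absa_sin6 : r ^+ 5 * sin (6 * eta) = sin eta * (1 - 4 * r ^+ 2 + 3 * r ^+ 4).
Proof.
rewrite (absaX_sinM_rec 3) absa_sin5 (absaX_sinM_rec 1) expr1 absa_sin2 absa_sin3.
ring.
Qed.

Lemma absa_sin_le x : eta <= pi / 4 -> - (pi / 2) <= x <= 2 * eta ->
  r * sin x <= sin eta.
Proof.
move=> eta_le x_bd; rewrite -absa_sin2 ler_wpM2l ?(ltW absa_gt0) //.
by apply: ler_sin_pihalf; lra.
Qed.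

End Modulus.

Lemma ltr_absa (R : realType) (x y : R) :
  0 < x -> x < y -> y < pi / 3 -> absa x < absa y.
Proof.
move=> x0 xy y3.
have x_bd : 0 < x < pi / 3 by lra.
have y_bd : 0 < y < pi / 3 by lra.
have : cos y < cos x by rewrite ltr_cos ?in_itv /=; lra.
have := absa_cos x_bd; have := absa_cos y_bd.
have := absa_gt0 y_bd; have := cos_eta_gt y_bd; nra.
Qed.

Lemma ltr_absaX (R : realType) (x y : R) n : 0 < x -> x < y -> y < pi / 3 ->
  absa x ^+ n.+1 < absa y ^+ n.+1.
Proof.
move=> x0 xy y3; have x_bd : 0 < x < pi / 3 by lra.
by rewrite ltrXn2r // ?ltr_absa // ltW // absa_gt0.
Qed.

Section PhiFormulas.
Context {R : realType}.
Variable eta : R.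
Hypothesis eta_bd : 0 < eta < pi / 3.
Local Notation r := (absa eta).

Lemma PhiE k : Phi k eta =
  (1 - r ^+ 2 - r ^+ 4) * sin ((k%:R - 1) * eta) + r ^+ 3 * sin (k%:R * eta)
  + r ^+ k * sin eta.
Proof.
have := absa_sinDB eta_bd ((k%:R - 1) * eta).
have -> : (k%:R - 1) * eta + eta = k%:R * eta by ring.
have -> : (k%:R - 1) * eta - eta = (k%:R - 2) * eta by ring.
by rewrite /Phi => <-; ring.
Qed.

Lemma PhiSE k : Phi k.+1 eta = (1 - r ^+ 4) * sin (k%:R * eta)
  - r ^+ 3 * sin ((k%:R - 1) * eta) + r ^+ k.+1 * sin eta.
Proof. by rewrite /Phi -natr1; congr (_ * sin _ - _ * sin _ + _); ring. Qed.

Lemma Phi4_factor : exists2 b, 0 < b & Phi 4 eta = b * (1 - 2 * r ^+ 4).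
Proof.
have r2 := absaX_gt0 eta_bd 2; have s0 := sin_eta_gt0 eta_bd.
exists (sin eta * (1 - r ^+ 2) / r ^+ 2).
  by rewrite divr_gt0 // mulr_gt0 // subr_gt0 absaX_lt1.
apply: (mulIf (lt0r_neq0 r2)); rewrite [RHS]mulrAC divfK ?lt0r_neq0 // PhiSE.
have -> : (3%:R - 1) * eta = 2 * eta by ring.
rewrite (_ : _ * r ^+ 2 = (1 - r ^+ 4) * (r ^+ 2 * sin (3 * eta))
  - r ^+ 4 * (r * sin (2 * eta)) + r ^+ 6 * sin eta); last by ring.
by rewrite absa_sin3 // absa_sin2 //; ring.
Qed.

Lemma Phi_gt0 k : (0 < k)%N -> eta <= pi / 4 -> k%:R * eta <= pi -> 0 < Phi k eta.
Proof.
move=> k_gt0 eta_le keta_le; rewrite PhiE; have /andP[eta0 _] := eta_bd.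
have k1 : 1 <= k%:R :> R by rewrite ler1n.
have s0 := sin_eta_gt0 eta_bd; have rX := absaX_gt0 eta_bd.
apply: ltr_wpDl; last by rewrite mulr_gt0.
have r2 := absa_sqr_le eta_bd eta_le; have r4 := absa4_le eta_bd eta_le.
apply: addr_ge0; apply: mulr_ge0.
- lra.
- by apply: sin_ge0_pi; nra.
- exact: ltW.
- by apply: sin_ge0_pi; nra.
Qed.

Lemma PhiS_le0 k : (4 <= k)%N -> r ^+ 4 <= 1 / 2 ->
  pi <= k%:R * eta -> (k%:R - 1) * eta <= pi -> Phi k.+1 eta <= 0.
Proof.
move=> k4 r4 keta_ge keta_le; rewrite PhiSE; pose d := k%:R * eta - pi.
have -> : k%:R * eta = d + pi by rewrite /d; ring.
have -> : (k%:R - 1) * eta = pi - (eta - d) by rewrite /d; ring.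
have rX := absaX_gt0 eta_bd; have /andP[eta0 eta3] := eta_bd.
have sd : 0 <= sin d by apply: sin_ge0_pi; rewrite /d; lra.
have sed : 0 <= sin (eta - d) by apply: sin_ge0_pi; rewrite /d; lra.
have s_le : sin eta <= sin d + sin (eta - d).
  by rewrite -{1}[eta](subrK d) addrC ler_sinD.
have rk_le3 : r ^+ k.+1 <= r ^+ 3 by apply/ler_absaX/leqW/ltnW.
have rk_le4 : r ^+ k.+1 <= 1 - r ^+ 4.
  by have := ler_absaX eta_bd (leqW k4); lra.
rewrite sinDpi sin_piB.
have := ler_wpM2l (ltW (rX k.+1)) s_le.
have := ler_wpM2r sd rk_le4; have := ler_wpM2r sed rk_le3.
lra.
Qed.

End PhiFormulas.

Section PhiDrift.
Context {R : realType}.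
Implicit Types x y eta : R.

(* Up to the factor |a|^(n+4), what Phi_(n+4) subtracts from its leading
   term: see [Phi_drift]. *)
Definition drift n x : R := - ((2 * cos x) ^+ n.+1 * sin (n.+4%:R * x)) - sin x.

Lemma Phi_drift n eta : 0 < eta < pi / 3 -> Phi n.+4 eta =
  (1 - absa eta ^+ 2 - absa eta ^+ 4) * sin (n.+3%:R * eta)
  - absa eta ^+ n.+4 * drift n eta.
Proof.
move=> eta_bd; rewrite PhiE // /drift; set r := absa eta.
have -> : n.+4%:R - 1 = n.+3%:R :> R by rewrite -(natr1 n.+3) addrK.
have -> : r ^+ 3 = r ^+ n.+4 * (2 * cos eta) ^+ n.+1.
  have rcos : r * (2 * cos eta) = 1 by rewrite mulrCA mulrA absa_cos.
  by rewrite -(addn3 n.+1) exprD mulrAC -exprMn rcos expr1n mul1r.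
ring.
Qed.

Definition drift' n x : R :=
  (2 * cos x) ^+ n * (n.+1%:R * (2 * sin x) * sin (n.+4%:R * x)
    - n.+4%:R * (2 * cos x) * cos (n.+4%:R * x)) - cos x.

Lemma is_derive_drift n x : is_derive x 1 (drift n) (drift' n x).
Proof.
have -> : drift n =
    - (((2 : R) \*: @cos R) ^+ n.+1 * (@sin R \o (n.+4%:R \*: id))) - @sin R.
  by apply/funext => y; rewrite /drift /= !fctE.
apply: is_derive_eq.
rewrite /drift' /GRing.scale /= !fctE /GRing.scale /=.
by rewrite -[2 *: cos x]/(2 * cos x) exprS; ring.
Qed.

Lemma drift'_gt0 n x : 0 < x <= pi / 4 -> pi <= n.+4%:R * x <= pi + x ->
  0 < drift' n x.
Proof.
move=> x_bd nx_bd; pose d := n.+4%:R * x - pi.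
have d_bd : 0 <= d <= x by rewrite /d; lra.
have [sE cE] : sin (n.+4%:R * x) = - sin d /\ cos (n.+4%:R * x) = - cos d.
  by rewrite -sinDpi -cosDpi /d subrK.
have cx_gt0 : 0 < cos x by apply: cos_gt0_pihalf; lra.
have cd_ge : cos x <= cos d by rewrite leNgt ltr_cos ?in_itv /= -?leNgt; lra.
have cx2 : 1 / 2 <= cos x ^+ 2 by apply: cos_sqr_ge; lra.
have cxd : 0 <= cos (x + d) by apply: cos_ge0_pihalf; lra.
have pow_ge1 : 1 <= (2 * cos x) ^+ n by apply: exprn_ege1; nra.
have n4E : n.+4%:R = n.+1%:R + 3 :> R by rewrite -natrD addn3.
have inner_ge3 : 3 <= 2 * n.+1%:R * cos (x + d) + 6 * (cos x * cos d).
  have := mulr_ge0 (ler0n R n.+1) cxd; nra.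
rewrite /drift' sE cE n4E.
have -> : n.+1%:R * (2 * sin x) * - sin d - (n.+1%:R + 3) * (2 * cos x) * - cos d =
    2 * n.+1%:R * cos (x + d) + 6 * (cos x * cos d) by rewrite cosD; ring.
by have := cos_le1 x; nra.
Qed.

Lemma drift_lt n x y : (0 < n)%N ->
  pi <= n.+4%:R * x -> x < y -> (n.+4%:R - 1) * y <= pi -> drift n x < drift n y.
Proof.
move=> n_gt0 nx xy ny.
have n5 : 5 <= n.+4%:R :> R by rewrite ler_nat.
have derivable_drift z : derivable (drift n) z 1 by case: (is_derive_drift n z).
have drift_cont : {within `[x, y], continuous (drift n)}.
  apply: continuous_subspaceT => z; apply: differentiable_continuous.
  exact/derivable1_diffP.
apply: (@gtr0_derive1_lt_cc _ (drift n) x y) => // [z||].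
- rewrite in_itv /= => z_bd; rewrite derive1E; case: (is_derive_drift n z) => _ ->.
  have z_gt0 : 0 < z by nra.
  by apply: drift'_gt0; nra.
- by rewrite in_itv /= lexx ltW.
- by rewrite in_itv /= lexx ltW.
Qed.

Lemma Phi4_lt0_mono x y : 0 < x -> x < y -> y < pi / 3 -> Phi 4 x <= 0 -> Phi 4 y < 0.
Proof.
move=> x0 xy y3; have x_bd : 0 < x < pi / 3 by lra.
have y_bd : 0 < y < pi / 3 by lra.
have [b b0 ->] := Phi4_factor x_bd; have [d d0 ->] := Phi4_factor y_bd.
by rewrite pmulr_rle0 // pmulr_rlt0 //; have := ltr_absaX 3 x0 xy y3; lra.
Qed.

Lemma Phi_ge5_lt0_mono n x y : (0 < n)%N ->
  pi <= n.+4%:R * x -> x < y -> (n.+4%:R - 1) * y < pi ->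
  Phi n.+4 x <= 0 -> Phi n.+4 y < 0.
Proof.
move=> n_gt0 nx xy ny.
have drift_xy := drift_lt n_gt0 nx xy (ltW ny).
have n5 : 5 <= n.+4%:R :> R by rewrite ler_nat.
have n4E : n.+4%:R - 1 = n.+3%:R :> R by rewrite -(natr1 n.+3) addrK.
have x0 : 0 < x by nra.
have y4 : y <= pi / 4 by nra.
have x_bd : 0 < x < pi / 3 by lra.
have y_bd : 0 < y < pi / 3 by lra.
rewrite !Phi_drift //.
have lead_gt0 : 0 < 1 - absa y ^+ 2 - absa y ^+ 4.
  by have := absa_sqr_le y_bd y4; have := absa4_le y_bd y4; lra.
have lead_le : 1 - absa y ^+ 2 - absa y ^+ 4 <= 1 - absa x ^+ 2 - absa x ^+ 4.
  have y3 : y < pi / 3 by lra.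
  by have := ltr_absaX 1 x0 xy y3; have := ltr_absaX 3 x0 xy y3; lra.
have sin_gt0 : 0 < sin (n.+3%:R * y) by apply: sin_gt0_pi; rewrite -n4E; nra.
have sin_le : sin (n.+3%:R * y) <= sin (n.+3%:R * x).
  by apply: ger_sin_pihalf; rewrite -n4E; nra.
have lead := ler_pM (ltW lead_gt0) (ltW sin_gt0) lead_le sin_le.
have := mulr_gt0 lead_gt0 sin_gt0; rewrite !subr_le0 !subr_lt0 => lead_y lead_x.
have drift_x : 0 < drift n x.
  by rewrite -(pmulr_rgt0 _ (absaX_gt0 x_bd n.+4)); lra.
have : absa x ^+ n.+4 * drift n x < absa y ^+ n.+4 * drift n y.
  by apply: ltr_pM => //; [exact/ltW/absaX_gt0|exact: ltW|apply: ltr_absaX; lra].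
lra.
Qed.

Lemma Phi_lt0_mono k x y : (4 <= k)%N ->
  pi <= k%:R * x -> x < y -> (k%:R - 1) * y < pi -> Phi k x <= 0 -> Phi k y < 0.
Proof.
case: k => [|[|[|[|[|n]]]]] // _ kx xy ky; last exact: Phi_ge5_lt0_mono.
by apply: Phi4_lt0_mono => //; nra.
Qed.

End PhiDrift.

(** * The window between two zeros *)

Section Window.
Context {R : realType}.
Implicit Types eta : R.

Record Phi_window (k : nat) eta : Prop := PhiWindow {
  window_k : (4 <= k)%N;
  window_lb : pi < (k%:R + 1) * eta;
  window_ub : (k%:R - 1) * eta < pi;
  window_Phi : 0 < Phi k eta;
  window_PhiS : Phi k.+1 eta <= 0
}.

Lemma absa4_lt k eta : (4 <= k)%N -> 0 < eta < pi / 3 ->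
  (k%:R - 1) * eta < pi -> 0 < Phi k eta -> absa eta ^+ 4 < 1 / 2.
Proof.
move=> k4 eta_bd ub; have /andP[eta0 _] := eta_bd.
move: k4; rewrite leq_eqVlt => /predU1P[<-|k5] Phi_gt0.
  have [b b0 Phi4E] := Phi4_factor eta_bd.
  by move: Phi_gt0; rewrite Phi4E pmulr_rgt0 //; lra.
have k5R : 5 <= k%:R :> R by rewrite (ler_nat R 5).
by have := absa4_le eta_bd ltac:(nra); lra.
Qed.

Lemma Phi_zeros_window k eta eta_k1 eta_k : (4 <= k)%N ->
  pi / k.+1%:R < eta_k1 < pi / k%:R -> Phi k.+1 eta_k1 = 0 ->
  pi / k%:R < eta_k < pi / (k%:R - 1) -> Phi k eta_k = 0 ->
  eta_k1 <= eta < eta_k -> Phi_window k eta.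
Proof.
move=> k4; have k4R : 4 <= k%:R :> R by rewrite (ler_nat R 4).
have kSE : k.+1%:R = k%:R + 1 :> R by rewrite natr1.
rewrite !ltr_pdivrMr ?ltr_pdivlMr; try lra.
move=> /andP[k1_gt k1_lt] Phi_k1 /andP[k_gt k_lt] Phi_k /andP[eta_ge eta_lt].
have lb : pi < (k%:R + 1) * eta by nra.
have ub : (k%:R - 1) * eta < pi by nra.
have eta_bd : 0 < eta < pi / 3 by apply/andP; split; nra.
have Phi_eta : 0 < Phi k eta.
  have [keta|keta] := leP (k%:R * eta) pi.
    by apply: Phi_gt0 => //; [exact: leq_trans k4|nra].
  rewrite ltNge; apply/negP => Phi_le.
  by have := Phi_lt0_mono k4 (ltW keta) eta_lt ltac:(nra) Phi_le; rewrite Phi_k ltxx.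
split=> //; have [keta|keta] := leP pi (k%:R * eta).
  by apply: PhiS_le0 => //; [exact/ltW/(absa4_lt k4)|exact: ltW].
move: eta_ge; rewrite le_eqVlt => /predU1P[<-|eta_gt]; first by rewrite Phi_k1.
apply/ltW/(Phi_lt0_mono (leqW k4) _ eta_gt); rewrite ?Phi_k1 ?kSE //; nra.
Qed.

Section WindowBounds.
Variables (k : nat) (eta : R).
Hypothesis W : Phi_window k eta.

Lemma window_natr_ge4 : 4 <= k%:R :> R.
Proof. by rewrite (ler_nat R 4) (window_k W). Qed.

Lemma window_eta : 0 < eta < pi / 3.
Proof.
have := window_natr_ge4; have := window_lb W; have := window_ub W.
by move=> *; apply/andP; split; nra.
Qed.

Lemma window_absa4 : absa eta ^+ 4 < 1 / 2.
Proof. exact: absa4_lt (window_k W) window_eta (window_ub W) (window_Phi W). Qed.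

Lemma window_quarter : k%:R * eta <= pi -> eta <= pi / 4.
Proof. by have := window_eta; have := window_natr_ge4; nra. Qed.

Lemma window_quarter_or4 : eta <= pi / 4 \/ k = 4%N.
Proof.
have := window_k W; rewrite leq_eqVlt => /predU1P[|k5]; [by right|left].
have k5R : 5 <= k%:R :> R by rewrite (ler_nat R 5).
have := window_ub W; have := window_eta; nra.
Qed.

End WindowBounds.
End Window.

(** * The maps, the vertices and the edges *)

Section Maps.
Context {R : realType}.
Variable eta : R.
Local Notation r := (absa eta).
Local Notation c := (c_of eta).
Implicit Types (t s : R) (x y z : R * R).

Lemma height_f1 t z : height t (f1 eta z) = r * height (t - eta) z.
Proof. by rewrite /height /f1 /= sinB cosB; ring. Qed.

Lemma height_f2 t z : height t (f2 eta z) = sin t - r * height (t + eta) z.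
Proof. by rewrite /height /f2 /= sinD cosD; ring. Qed.

Lemma cpow_a_of j : cpow (a_of eta) j = polar (r ^+ j) (j%:R * eta).
Proof.
elim: j => [|j IH] /=; first by rewrite /polar mul0r cos0 sin0; congr (_, _); ring.
rewrite IH -natr1 mulrDl mul1r addrC /polar /cmul cosD sinD exprS /=.
by congr (_, _); ring.
Qed.

Lemma height_zj t j : height t (zj eta j) = c * r ^+ j.+1 * sin (t - j.+1%:R * eta).
Proof. by rewrite -mulrA -height_polar /zj cpow_a_of /height /=; ring. Qed.

Lemma height_wj t j :
  height t (wj eta j) = sin t - c * r ^+ j.+2 * sin (t - j%:R * eta).
Proof.
rewrite (_ : c * r ^+ j.+2 * _ = c * r ^+ 2 * (r ^+ j * sin (t - j%:R * eta))).
  by rewrite -height_polar /wj cpow_a_of /height /=; ring.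
by rewrite !exprS; ring.
Qed.

Lemma height_b0 t :
  height t (bj eta 0) = r * sin (t - eta) + c * r ^+ 4 * sin t.
Proof. by rewrite /height /bj /= sinB; ring. Qed.

Lemma f1_zj j : f1 eta (zj eta j) = zj eta j.+1.
Proof.
apply: height_inj => t; rewrite height_f1 !height_zj -(natr1 j.+1) [in RHS]exprS.
by rewrite (_ : t - eta - _ = t - (j.+1%:R + 1) * eta); ring.
Qed.

Lemma f2_zj j : f2 eta (zj eta j) = wj eta j.
Proof.
apply: height_inj => t; rewrite height_f2 height_zj height_wj -(natr1 j) [in RHS]exprS.
by rewrite (_ : t + eta - _ = t - j%:R * eta); ring.
Qed.

Hypothesis eta_bd : 0 < eta < pi / 3.

Lemma directed_f1 t x y : directed t x y -> directed (t + eta) (f1 eta x) (f1 eta y).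
Proof.
case=> rho rho0 ->; exists (r * rho); first by rewrite mulr_gt0 ?absa_gt0.
apply: height_inj => s; rewrite heightD !height_f1 heightD !height_polar.
by rewrite (_ : s - eta - t = s - (t + eta)); ring.
Qed.

Lemma directed_f2 t x y :
  directed t x y -> directed (t + pi - eta) (f2 eta x) (f2 eta y).
Proof.
case=> rho rho0 ->; exists (r * rho); first by rewrite mulr_gt0 ?absa_gt0.
apply: height_inj => s; rewrite heightD !height_f2 heightD !height_polar.
rewrite (_ : s + eta - t = s - (t + pi - eta) + pi); last by ring.
by rewrite sinDpi; ring.
Qed.

Lemma height_f1_le t x z :
  height t z <= height t x ->
  height (t + eta) (f1 eta z) <= height (t + eta) (f1 eta x).
Proof. by rewrite !height_f1 addrK ler_pM2l // absa_gt0. Qed.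

Lemma height_f2_le t x z : height t z <= height t x ->
  height (t + pi - eta) (f2 eta z) <= height (t + pi - eta) (f2 eta x).
Proof.
by rewrite !height_f2 subrK !heightDpi lerD2l lerN2 !mulrN lerN2 ler_pM2l // absa_gt0.
Qed.

Lemma height_f1_f2 t z :
  height t (f1 eta (f2 eta z)) = height t (f2 eta (f1 eta z)) - r * sin (t + eta).
Proof.
rewrite height_f1 !height_f2 height_f1 subrK addrK.
by rewrite -(absa_sinDB eta_bd t); ring.
Qed.

Lemma c_ofE : c * (1 - r ^+ 4) = 1.
Proof. by rewrite /c_of div1r mulVf // gt_eqF // subr_gt0 absaX_lt1. Qed.

Lemma c_of_gt0 : 0 < c.
Proof. by rewrite /c_of div1r invr_gt0 subr_gt0 absaX_lt1. Qed.

Lemma f2_w1 : f2 eta (wj eta 1) = bj eta 0.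
Proof.
apply: height_inj => t; rewrite height_f2 height_wj height_b0 mul1r addrK.
by rewrite -{1}(absa_sinDB eta_bd t); ring.
Qed.

Lemma f2f2f1f1E z :
  f2 eta (f2 eta (f1 eta (f1 eta z))) = zj eta 0 + (r ^+ 4) *: (z - zj eta 0).
Proof.
apply: height_inj => t; rewrite heightD heightZ heightB !height_f2 !height_f1 height_zj.
rewrite !addrK mul1r expr1 -{1}(absa_sinDB eta_bd t).
have c_cancel : c * (1 - r ^+ 4) * (r * sin (t - eta)) = r * sin (t - eta).
  by rewrite c_ofE mul1r.
lra.
Qed.

Lemma f2_w2 : f2 eta (wj eta 2) = zj eta 0.
Proof. by rewrite -f2_zj -!f1_zj f2f2f1f1E subrr scaler0 addr0. Qed.

Lemma directed_zj j : directed (pi + j%:R * eta) (zj eta j) (zj eta j.+1).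
Proof.
elim: j => [|j IH]; last first.
  have := directed_f1 IH; rewrite !f1_zj -natr1.
  by congr (directed _ _ _); ring.
exists (c * r ^+ 2); first by rewrite mulr_gt0 ?c_of_gt0 ?absaX_gt0.
apply: height_inj => t; rewrite heightD height_polar !height_zj mul0r addr0 mul1r.
have -> : sin (t - pi) = - sin t by rewrite -[in RHS](subrK pi t) sinDpi opprK.
rewrite -(absa_sinDB eta_bd (t - eta)) subrK.
by rewrite (_ : t - eta - eta = t - 2 * eta); ring.
Qed.

Lemma directed_wj j :
  directed (pi *+ 2 + (j%:R - 1) * eta) (wj eta j) (wj eta j.+1).
Proof.
have := directed_f2 (directed_zj j); rewrite !f2_zj.
by congr (directed _ _ _); ring.
Qed.

Lemma directed_b0z0 : directed (pi - eta) (bj eta 0) (zj eta 0).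
Proof.
apply/directedD2pi; have := directed_f2 (directed_wj 1); rewrite f2_w1 f2_w2.
by congr (directed _ _ _); ring.
Qed.

End Maps.

Section EdgeAngle.
Context {R : realType}.
Variables (k : nat) (eta : R).
Hypothesis W : Phi_window k eta.
Local Notation r := (absa eta).
Local Notation c := (c_of eta).
Local Notation M := (k%:R : R).
Let eta_bd := window_eta W.

Lemma height_w1Bzk t : height t (wj eta 1) - height t (zj eta k) =
  c * ((1 - r ^+ 4) * sin t - r ^+ 3 * sin (t - eta)
       - r ^+ k.+1 * sin (t - (M + 1) * eta)).
Proof.
have sinE : sin t = c * (1 - r ^+ 4) * sin t by rewrite c_ofE // mul1r.
by rewrite height_wj height_zj natr1 mul1r {1}sinE; ring.
Qed.

Lemma height_w1_lt_zk :
  height (pi + (M - 1) * eta) (wj eta 1) < height (pi + (M - 1) * eta) (zj eta k).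
Proof.
rewrite -subr_lt0 height_w1Bzk pmulr_rlt0 ?c_of_gt0 // -oppr_gt0.
rewrite (addrC pi) sinDpi.
rewrite (_ : (M - 1) * eta + pi - eta = (M - 2) * eta + pi); last by ring.
rewrite (_ : (M - 1) * eta + pi - (M + 1) * eta = pi - 2 * eta); last by ring.
rewrite sinDpi sin_piB (exprSr r k) -(mulrA (r ^+ k)) absa_sin2 //.
by have := window_Phi W; rewrite /Phi; lra.
Qed.

Lemma height_zk_le_w1 :
  height (pi + M * eta) (zj eta k) <= height (pi + M * eta) (wj eta 1).
Proof.
rewrite -subr_ge0 height_w1Bzk pmulr_rge0 ?c_of_gt0 // (addrC pi) sinDpi.
rewrite (_ : M * eta + pi - eta = (M - 1) * eta + pi); last by ring.
rewrite (_ : M * eta + pi - (M + 1) * eta = pi - eta); last by ring.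
by rewrite sinDpi sin_piB; have := window_PhiS W; rewrite PhiSE; lra.
Qed.

Lemma height_w1_le_zk_2piB :
  height (pi *+ 2 - eta) (wj eta 1) <= height (pi *+ 2 - eta) (zj eta k).
Proof.
have lb := window_lb W; have ub := window_ub W.
have s0 := sin_eta_gt0 eta_bd; have rX := absaX_gt0 eta_bd.
rewrite addrC -subr_le0 height_w1Bzk pmulr_rle0 ?c_of_gt0 // sinD2pi sinN.
rewrite (_ : - eta + pi *+ 2 - eta = - (2 * eta) + pi *+ 2); last by ring.
rewrite (_ : _ - (M + 1) * eta = - ((M + 2) * eta) + pi *+ 2); last by ring.
rewrite !sinD2pi !sinN !mulrN !opprK (exprSr r 2) -(mulrA (r ^+ 2)) absa_sin2 //.
suff : r ^+ k.+1 * sin ((M + 2) * eta) <= sin eta * (1 - r ^+ 2 - r ^+ 4) by lra.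
case: (window_quarter_or4 W) => [eta4|k4]; last first.
  rewrite k4 (_ : 4%:R + 2 = 6) ?absa_sin6 ?ler_pM2l //; last by ring.
  have r4 := window_absa4 W; rewrite (exprM _ 2 2) in r4 *; nra.
have r2 := absa_sqr_le eta_bd eta4; have r4 := absa4_le eta_bd eta4.
apply: (@le_trans _ _ 0); last by rewrite mulr_ge0 //; lra.
rewrite pmulr_rle0 // -[(M + 2) * eta](subrK (pi *+ 2)) sinD2pi.
by apply: sin_le0_Npi; lra.
Qed.

Lemma height_zk_lt_w1_2pi : height (pi *+ 2) (zj eta k) < height (pi *+ 2) (wj eta 1).
Proof.
have lb := window_lb W; have ub := window_ub W.
have s0 := sin_eta_gt0 eta_bd; have rX := absaX_gt0 eta_bd.
rewrite -subr_gt0 height_w1Bzk pmulr_rgt0 ?c_of_gt0 // sin2pi mulr0 sub0r.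
rewrite !(addrC (pi *+ 2)) !sinD2pi !sinN !mulrN !opprK.
case: (window_quarter_or4 W) => [eta4|k4]; last first.
  rewrite k4 (_ : 4%:R + 1 = 5); last by ring.
  rewrite (exprS r 4) -(mulrA r (r ^+ 4)) absa_sin5 //.
  rewrite (_ : _ + _ = r * sin eta * (1 - r ^+ 2) ^+ 2); last by ring.
  apply: mulr_gt0; first exact/mulr_gt0/s0/absa_gt0.
  by apply: exprn_gt0; rewrite subr_gt0 absaX_lt1.
rewrite -[(M + 1) * eta](subrK pi) sinDpi mulrN subr_gt0.
apply: (@le_lt_trans _ _ (r ^+ k * sin eta)).
  rewrite exprSr -(mulrA (r ^+ k)) ler_wpM2l ?(ltW (rX k)) //.
  by apply: absa_sin_le => //; lra.
by rewrite ltr_pM2r // ltr_iXn2l ?absa_gt0 ?absa_lt1 // (window_k W).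
Qed.

Lemma directed_zkw1 : exists beta,
  [/\ pi + (M - 1) * eta < beta < pi *+ 2,
      pi *+ 2 - eta <= beta <= pi + M * eta
    & directed beta (zj eta k) (wj eta 1)].
Proof.
have M4 := window_natr_ge4 W; have ub := window_ub W.
have /andP[eta0 eta3] := eta_bd.
have [|beta beta_bd beta_edge] := directed_ivt _ height_w1_lt_zk height_zk_lt_w1_2pi.
  by nra.
exists beta; split=> //; apply/andP; split.
  by apply: (directed_angle_ge beta_edge) height_w1_le_zk_2piB; nra.
by apply: (directed_angle_le beta_edge) height_zk_le_w1; nra.
Qed.

End EdgeAngle.

Section Estimates.
Context {R : realType}.
Variables (k : nat) (eta : R).
Hypothesis W : Phi_window k eta.
Local Notation M := (k%:R : R).
Local Notation r := (absa eta).
Local Notation c := (c_of eta).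
Let eta_bd := window_eta W.

Lemma height_zj_edge j :
  height (pi + j%:R * eta) (zj eta j) = c * r ^+ j.+1 * sin eta.
Proof.
rewrite height_zj -(natr1 j).
by rewrite (_ : _ - _ * eta = pi - eta) ?sin_piB //; ring.
Qed.

Lemma height_zj_edge_ge0 j : 0 <= height (pi + j%:R * eta) (zj eta j).
Proof.
rewrite height_zj_edge; apply/ltW/mulr_gt0; last exact: sin_eta_gt0.
by apply: mulr_gt0; [exact: c_of_gt0|exact: absaX_gt0].
Qed.

Lemma sinM_eta_ge0 j : (j < k)%N -> 0 <= sin (j%:R * eta).
Proof.
move=> jk; have : j%:R + 1 <= M by rewrite natr1 ler_nat.
have := ler0n R j; have := window_ub W; have := eta_bd => ? ? ? ?.
by apply: sin_ge0_pi; nra.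
Qed.

Lemma height_zSk_le_w1 : M * eta <= pi ->
  height (pi *+ 2) (zj eta k.+1) <= height (pi *+ 2) (wj eta 1).
Proof.
move=> Meta; have pi0 := pi_gt0 R; have lb := window_lb W.
have s0 := sin_eta_gt0 eta_bd.
have rX := absaX_gt0 eta_bd; have c0 := c_of_gt0 eta_bd.
rewrite height_zj height_wj sin2pi.
rewrite (_ : pi *+ 2 - k.+2%:R * eta = pi - ((M + 2) * eta - pi)); last first.
  by rewrite -(natr1 k.+1) -(natr1 k); ring.
rewrite (_ : pi *+ 2 - 1%:R * eta = - eta + pi *+ 2); last by ring.
rewrite sin_piB sinD2pi sinN mulrN sub0r opprK.
apply: (@le_trans _ _ (c * r ^+ k.+1 * sin eta)).
  have crk : 0 < c * r ^+ k.+1 by exact: mulr_gt0.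
  rewrite (exprSr r k.+1) mulrA -(mulrA (c * _)) ler_pM2l //.
  by apply: absa_sin_le => //; [exact: window_quarter Meta|lra].
by rewrite ler_pM2r // ler_pM2l // ler_absaX // !ltnS (leq_trans _ (window_k W)).
Qed.

Lemma height_w0_le_zj j : (j < k)%N -> eta <= pi / 4 \/ j = 2 ->
  height (pi + j%:R * eta) (wj eta 0) <= height (pi + j%:R * eta) (zj eta j).
Proof.
have c0 := c_of_gt0 eta_bd; have cE := c_ofE eta_bd.
have w0E : height (pi + j%:R * eta) (wj eta 0) =
    - ((1 - c * r ^+ 2) * sin (j%:R * eta)).
  by rewrite height_wj mul0r subr0 (addrC pi) sinDpi; ring.
move=> jk [eta4|j2].
  apply: le_trans (height_zj_edge_ge0 j); rewrite w0E oppr_le0.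
  apply: mulr_ge0; last exact: sinM_eta_ge0.
  by have := absa_sqr_le eta_bd eta4; nra.
have sin2_ge0 := sinM_eta_ge0 jk.
rewrite w0E height_zj_edge j2 in sin2_ge0 *.
rewrite -(absa_sin2 eta_bd) mulrA -mulNr ler_wpM2r //.
by have := absaX_lt1 eta_bd 1; nra.
Qed.

Lemma height_f2b0_le_zj j : j.+2 = k -> M * eta <= pi ->
  height (pi + j%:R * eta) (f2 eta (bj eta 0)) <= height (pi + j%:R * eta) (zj eta j).
Proof.
move=> jk Meta; apply: le_trans (height_zj_edge_ge0 j).
have jM : j%:R = M - 2 by rewrite -jk -!natr1; ring.
have M4 := window_natr_ge4 W; have lb := window_lb W.
have eta4 := window_quarter W Meta; have r2 := absa_sqr_le eta_bd eta4.
have cE := c_ofE eta_bd; have c0 := c_of_gt0 eta_bd.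
have cr5 : c * r ^+ 5 <= 1 - r ^+ 2.
  have r5 : r ^+ 5 <= r ^+ 4 by apply: ler_absaX.
  have r5_le : r ^+ 5 <= (1 - r ^+ 2) * (1 - r ^+ 4) by nra.
  by have := ler_wpM2l (ltW c0) r5_le; rewrite (mulrCA c (1 - _)) cE mulr1.
have sin_le : sin ((M - 1) * eta) <= sin ((M - 2) * eta).
  have [acute|obtuse] := leP (pi / 2) ((M - 2) * eta).
    by apply: ger_sin_pihalf; nra.
  by rewrite -sin_piB; apply: ler_sin_pihalf; nra.
have sin_ge0 : 0 <= sin ((M - 2) * eta) by rewrite -jM sinM_eta_ge0 // -jk.
rewrite height_f2 height_b0 jM addrK.
rewrite (_ : pi + _ + eta = (M - 1) * eta + pi); last by ring.
rewrite (addrC pi) !sinDpi.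
have cr5_ge0 : 0 <= c * r ^+ 5 by rewrite ltW // mulr_gt0 ?absaX_gt0.
have := ler_wpM2l cr5_ge0 sin_le; have := ler_wpM2r sin_ge0 cr5; lra.
Qed.

Lemma height_f2wj_le_zj j : (j.+2 < k)%N ->
  height (pi + j%:R * eta) (f2 eta (wj eta j.+2))
  <= height (pi + j%:R * eta) (zj eta j).
Proof.
move=> jk; have r0 := absa_gt0 eta_bd; have s0 := sin_eta_gt0 eta_bd.
rewrite height_zj_edge height_f2 height_wj.
rewrite (_ : pi + j%:R * eta + eta - j.+2%:R * eta = pi - eta); last first.
  by rewrite -!natr1; ring.
rewrite (_ : pi + j%:R * eta + eta = (j%:R * eta + eta) + pi); last by ring.
rewrite (addrC pi) !sinDpi sin_piB -{1}(absa_sinDB eta_bd (j%:R * eta)).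
have cE : r ^+ j.+1 * sin eta = c * (1 - r ^+ 4) * (r ^+ j.+1 * sin eta).
  by rewrite c_ofE // mul1r.
suff : 0 <= r ^+ j.+1 * sin eta + r * sin (j%:R * eta - eta).
  by rewrite !exprS in cE *; lra.
case: j jk {cE} => [|j] jk; first by rewrite mul0r sub0r sinN expr1; lra.
apply: addr_ge0; apply: mulr_ge0; try exact: ltW; first exact/ltW/absaX_gt0.
have -> : j.+1%:R * eta - eta = j%:R * eta by rewrite -natr1; ring.
by apply: sinM_eta_ge0; lia.
Qed.

End Estimates.

(** * The polygon *)

Section VertexList.
Context {R : realType}.
Variables (k : nat) (eta : R).
Local Notation v i := (nth (0, 0) (vertex_list eta k) i).

Lemma size_vertex_list : size (vertex_list eta k) = (k + k).+2.
Proof. by rewrite /= size_cat !size_map !size_iota. Qed.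

Let nth_vertexS i : v i.+1 =
  nth (0, 0) ([seq zj eta j | j <- iota 0 k.+1] ++ [seq wj eta j | j <- iota 1 k]) i.
Proof. by []. Qed.

Lemma nth_vertex_zj j : (j <= k)%N -> v j.+1 = zj eta j.
Proof.
move=> jk; rewrite nth_vertexS nth_cat size_map size_iota ltnS jk.
by rewrite (nth_map 0%N) ?size_iota // nth_iota.
Qed.

Lemma nth_vertex_wj j : (0 < j <= k)%N -> v (k.+1 + j) = wj eta j.
Proof.
move=> /andP[j0 jk]; rewrite addSn nth_vertexS nth_cat size_map size_iota.
rewrite ltnNge -addn1 leq_add2l j0 /=.
rewrite (nth_map 0%N) ?size_iota ?nth_iota; try lia.
by congr (wj eta _); lia.
Qed.

Lemma nth_vertex_f2 i : 0 < eta < pi / 3 -> (0 < k)%N -> (1 < i <= k.+2)%N ->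
  v ((k + i) %% (k + k).+2) = f2 eta (v i).
Proof.
move=> eta_bd k0 /andP[i1]; rewrite leq_eqVlt => /predU1P[->|ik].
  have -> : (k + k.+2 = (k + k).+2)%N by lia.
  by rewrite modnn -(addn1 k.+1) nth_vertex_wj // f2_w1.
rewrite modn_small; last by lia.
rewrite -(prednK (ltnW i1)) nth_vertex_zj ?f2_zj; last by lia.
by rewrite -addSnnS nth_vertex_wj //; lia.
Qed.

End VertexList.

Section Polygon.
Context {R : realType}.
Variables (k : nat) (eta beta : R).
Hypothesis W : Phi_window k eta.
Local Notation M := (k%:R : R).
Hypothesis beta_open : pi + (M - 1) * eta < beta < pi *+ 2.
Hypothesis beta_closed : pi *+ 2 - eta <= beta <= pi + M * eta.
Hypothesis beta_edge : directed beta (zj eta k) (wj eta 1).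

Local Notation n := ((k + k).+2).
Local Notation v i := (nth (0, 0) (vertex_list eta k) i).
Let eta_bd := window_eta W.
Let k_ge4 := window_k W.

(* Edge 0 goes from b_0 to z_0 and edge j + 1 starts at z_j; the map f2 carries
   the edges 2, ..., k + 1 to the edges k + 2, ..., 2k + 1. *)
Definition first_angle i : R := if (i <= k)%N then pi + (i%:R - 1) * eta else beta.

Definition edge_angle i : R :=
  if (i <= k.+1)%N then first_angle i else first_angle (i - k) + pi - eta.

Lemma edge_angle_zj i : (i <= k)%N -> edge_angle i = pi + (i%:R - 1) * eta.
Proof. by move=> ik; rewrite /edge_angle /first_angle leqW ?ik. Qed.

Lemma edge_angle_zk : edge_angle k.+1 = beta.
Proof. by rewrite /edge_angle /first_angle leqnn ltnn. Qed.

Lemma edge_angleDk i : (1 < i <= k.+1)%N ->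
  edge_angle (k + i) = edge_angle i + pi - eta.
Proof.
move=> /andP[i1 ik]; rewrite /edge_angle ik addKn.
by have -> : (k + i <= k.+1)%N = false by lia.
Qed.

Lemma edge_angle_2pi : edge_angle k.+2 = pi *+ 2.
Proof. by rewrite -addn2 edge_angleDk ?edge_angle_zj; try lia; ring. Qed.

Lemma edge_index_ind (Q : nat -> Prop) :
  (forall i, (i <= k)%N -> Q i) -> Q k.+1 ->
  (forall i, (1 < i <= k.+1)%N -> Q (k + i)%N) -> forall i, (i < n)%N -> Q i.
Proof.
move=> Qz Qzk Qw i i_lt; have [/Qz//|] := leqP i k; rewrite leq_eqVlt.
move=> /predU1P[<-//|ki]; rewrite -(subnKC (ltnW (ltnW ki))); apply: Qw; lia.
Qed.

Let edge_turn_first i : (i <= k)%N ->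
  edge_angle i < edge_angle i.+1 < edge_angle i + pi.
Proof.
have := pi_gt0 R; have := eta_bd; have := beta_open; have := beta_closed => ? ? ? ? ik.
rewrite (edge_angle_zj ik); move: ik; rewrite leq_eqVlt => /predU1P[->|ik].
  by rewrite edge_angle_zk; lra.
by rewrite edge_angle_zj // -natr1; lra.
Qed.

Let edge_dir_first i : (i <= k.+1)%N -> directed (edge_angle i) (v i) (v i.+1).
Proof.
rewrite leq_eqVlt => /predU1P[->|].
  rewrite edge_angle_zk nth_vertex_zj // -(addn1 k.+1) nth_vertex_wj //.
  by rewrite (leq_trans _ k_ge4).
rewrite ltnS => ik; rewrite edge_angle_zj // nth_vertex_zj //.
case: i ik => [|i] ik; first by rewrite sub0r mulN1r; exact: directed_b0z0.
by rewrite -natr1 addrK nth_vertex_zj ?(ltnW ik) //; exact: directed_zj.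
Qed.

Let edge_dir i : (i < n)%N -> directed (edge_angle i) (v i) (v (i.+1 %% n)).
Proof.
move: i; apply: edge_index_ind => [i ik||i ik].
- by rewrite modn_small; [apply: edge_dir_first; exact: leqW|lia].
- by rewrite modn_small; [exact: edge_dir_first|lia].
- have -> : v (k + i) = f2 eta (v i) by rewrite -nth_vertex_f2 ?modn_small //; lia.
  rewrite -addnS nth_vertex_f2 ?edge_angleDk //; try lia.
  by apply: directed_f2 => //; apply: edge_dir_first; lia.
Qed.

Let edge_turn i : (i.+1 < n)%N -> edge_angle i < edge_angle i.+1 < edge_angle i + pi.
Proof.
move=> i1_lt; have i_lt : (i < n)%N by lia.
move: i i_lt i1_lt; apply: edge_index_ind => [i ik _||i ik iS].
- exact: edge_turn_first.
- rewrite edge_angle_zk edge_angle_2pi.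
  by have := beta_closed; have := beta_open; have := eta_bd; lra.
- rewrite -addnS !edge_angleDk; [|lia|lia].
  by have := @edge_turn_first i ltac:(lia); lra.
Qed.

Let edge_angle_last : edge_angle (k + k).+1 = beta + pi - eta.
Proof. by rewrite -addnS edge_angleDk ?edge_angle_zk //; lia. Qed.

Lemma clockwise_vertex_list : clockwise (vertex_list eta k) edge_angle.
Proof.
split; rewrite size_vertex_list.
- by lia.
- exact: edge_dir.
- exact: edge_turn.
- rewrite edge_angle_last edge_angle_zj // sub0r mulN1r.
  have := beta_open; have := eta_bd; have := window_natr_ge4 W.
  nra.
Qed.

Local Notation P := (halfplanes (vertex_list eta k) edge_angle).

Lemma supports_zj j t : (j <= k)%N -> edge_angle j <= t <= edge_angle j.+1 ->
  supports P t (zj eta j).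
Proof.
move=> jk ht; rewrite -(nth_vertex_zj eta jk).
apply: (clockwise_supports clockwise_vertex_list) ht.
by rewrite size_vertex_list; lia.
Qed.

Lemma supports_wj j t : (1 < j <= k)%N -> edge_angle j <= t <= edge_angle j.+1 ->
  supports P (t + pi - eta) (wj eta j).
Proof.
move=> jk ht; rewrite -(@nth_vertex_wj _ k); last by lia.
rewrite addSn; apply: (clockwise_supports clockwise_vertex_list).
  by rewrite size_vertex_list; lia.
by rewrite -addnS !edge_angleDk; [lra|lia|lia].
Qed.

Lemma supports_w1 t : beta <= t <= pi *+ 2 -> supports P t (wj eta 1).
Proof.
move=> ht; rewrite -(@nth_vertex_wj _ k); last by lia.
rewrite addn1; apply: (clockwise_supports clockwise_vertex_list).
  by rewrite size_vertex_list; lia.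
by rewrite edge_angle_zk edge_angle_2pi.
Qed.

Lemma supports_b0 t : beta + pi - eta <= t <= pi *+ 3 - eta -> supports P t (bj eta 0).
Proof.
move=> ht; apply: (clockwise_supports_wrap clockwise_vertex_list).
rewrite size_vertex_list edge_angle_last edge_angle_zj //; lra.
Qed.

Lemma supports_edge i : (i < n)%N -> supports P (edge_angle i) (v i).
Proof. by move=> i_lt; apply: halfplanes_supports; rewrite size_vertex_list. Qed.

Lemma halfplanes_zj j : (j <= k)%N -> P (zj eta j).
Proof.
move=> jk; rewrite -(nth_vertex_zj eta jk).
by apply: (halfplanes_vertex clockwise_vertex_list); rewrite size_vertex_list; lia.
Qed.

Lemma halfplanes_w1 : P (wj eta 1).
Proof.
rewrite -(@nth_vertex_wj _ k); last by lia.
by apply: (halfplanes_vertex clockwise_vertex_list); rewrite size_vertex_list; lia.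
Qed.

Lemma f1_edge_of_supports_zj t j x z : (j <= k)%N ->
  edge_angle j <= t - eta <= edge_angle j.+1 ->
  height t (zj eta j.+1) <= height t x -> P z -> height t (f1 eta z) <= height t x.
Proof.
move=> jk ht + Pz; apply: le_trans.
by have := height_f1_le eta_bd (supports_zj jk ht Pz); rewrite subrK f1_zj.
Qed.

Lemma f1_edge_of_supports_wj t j x z : (1 < j <= k)%N ->
  edge_angle j <= t - eta <= edge_angle j.+1 -> sin t <= 0 ->
  height t (zj eta j.+1) <= height t x -> P z ->
  height (t + pi - eta) (f1 eta z) <= height (t + pi - eta) (f2 eta x).
Proof.
move=> jk ht sin_t zx Pz; apply: le_trans (height_f2_le eta_bd zx).
have := height_f1_le eta_bd (supports_wj jk ht Pz).
rewrite (_ : t - eta + pi - eta + eta = t + pi - eta); last by ring.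
move/le_trans; apply; rewrite -f2_zj height_f1_f2 // f1_zj subrK sinDpi mulrN opprK.
by rewrite gerDl pmulr_rle0 ?absa_gt0.
Qed.

Lemma next_vertex_le t x : beta <= t <= pi *+ 2 -> supports P t x ->
  (pi + M * eta <= t -> height t (zj eta k.+1) <= height t x) ->
  exists j, [/\ (1 < j <= k)%N, edge_angle j <= t - eta <= edge_angle j.+1
    & height t (zj eta j.+1) <= height t x].
Proof.
have kE : k.-1.+1 = k by lia.
have k1_bd : (1 < k.-1 <= k)%N by lia.
have k_bd : (1 < k <= k)%N by lia.
have k1E : k.-1%:R = M - 1 by rewrite -kE -natr1 addrK.
have angle_k : edge_angle k = pi + (M - 1) * eta by exact: edge_angle_zj.
have angle_k1 : edge_angle k.-1 = pi + (M - 1 - 1) * eta.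
  by rewrite edge_angle_zj ?leq_pred // k1E.
have := beta_closed; have := beta_open => ? ? ht Px zSk.
have [t_lt|t_ge] := leP (t - eta) (pi + (M - 1) * eta).
  exists k.-1; rewrite kE angle_k angle_k1; split=> //; first by lra.
  by apply: Px; exact: halfplanes_zj.
exists k; rewrite edge_angle_zk angle_k; split=> //; first by lra.
by apply: zSk; lra.
Qed.

Lemma next_vertex_beta :
  exists j, [/\ (1 < j <= k)%N, edge_angle j <= beta - eta <= edge_angle j.+1
    & height beta (zj eta j.+1) <= height beta (zj eta k)].
Proof.
have := pi_gt0 R; have := eta_bd; have := beta_closed; have := beta_open => ? ? ? ?.
apply: next_vertex_le => [||_]; first by lra.
  by rewrite -edge_angle_zk -(nth_vertex_zj eta (leqnn k)); apply: supports_edge; lia.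
by apply: directed_height_le (directed_zj eta_bd k) _; lra.
Qed.

Lemma next_vertex_2pi :
  exists j, [/\ (1 < j <= k)%N, edge_angle j <= pi *+ 2 - eta <= edge_angle j.+1
    & height (pi *+ 2) (zj eta j.+1) <= height (pi *+ 2) (wj eta 1)].
Proof.
have := beta_open => ?; apply: next_vertex_le => [||?]; first by lra.
  by apply: supports_w1; lra.
by apply: height_zSk_le_w1 => //; lra.
Qed.

Lemma edge_angle_sin_le0 i : (0 < i <= k.+1)%N -> sin (edge_angle i) <= 0.
Proof.
have := pi_gt0 R; have := eta_bd; have := window_ub W.
have := beta_closed; have := beta_open => ? ? ? ? ? /andP[i0].
rewrite -[edge_angle i](subrK (pi *+ 2)) sinD2pi leq_eqVlt => /predU1P[->|].
  by rewrite edge_angle_zk; apply: sin_le0_Npi; lra.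
rewrite ltnS => ik; rewrite edge_angle_zj //.
have i1 : 1 <= i%:R :> R by rewrite ler1n.
have iM : i%:R <= M by rewrite ler_nat.
by apply: sin_le0_Npi; nra.
Qed.

Lemma halfplanes_intro z :
  height (pi - eta) z <= height (pi - eta) (bj eta 0) ->
  (forall j, (j < k)%N ->
     height (pi + j%:R * eta) z <= height (pi + j%:R * eta) (zj eta j)) ->
  height beta z <= height beta (zj eta k) ->
  (forall i, (1 < i <= k.+1)%N ->
     height (edge_angle i + pi - eta) z
     <= height (edge_angle i + pi - eta) (f2 eta (v i))) ->
  P z.
Proof.
move=> b0_le zj_le zk_le w_le i; rewrite size_vertex_list; move: i.
apply: edge_index_ind => [[_|i ik]||i ik].
- by rewrite edge_angle_zj // sub0r mulN1r.
- by rewrite edge_angle_zj // -natr1 addrK nth_vertex_zj ?(ltnW ik) //; exact: zj_le.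
- by rewrite edge_angle_zk nth_vertex_zj.
- have i_lt : (k + i < n)%N by lia.
  have i_bd : (1 < i <= k.+2)%N by lia.
  rewrite edge_angleDk // -(modn_small i_lt) nth_vertex_f2 //; first exact: w_le.
  exact: leq_trans k_ge4.
Qed.

Lemma f1_edge_b0 z : P z ->
  height (pi - eta) (f1 eta z) <= height (pi - eta) (bj eta 0).
Proof.
move=> Pz; have [j [jk j_angle j_le]] := next_vertex_2pi.
rewrite -(f2_w1 eta_bd) -!(heightD2pi (pi - eta)).
rewrite (_ : pi - eta + pi *+ 2 = pi *+ 2 + pi - eta); last by ring.
by apply: f1_edge_of_supports_wj jk j_angle _ j_le Pz; rewrite sin2pi.
Qed.

Lemma f1_edge_zj j z : (j < k)%N -> P z ->
  height (pi + j%:R * eta) (f1 eta z) <= height (pi + j%:R * eta) (zj eta j).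
Proof.
move=> jk Pz; apply: f1_edge_of_supports_zj (ltnW jk) _ _ Pz.
  by rewrite !edge_angle_zj ?(ltnW jk) // -natr1; have := eta_bd; lra.
by rewrite (directed_height (directed_zj eta_bd j)).
Qed.

Lemma f1_edge_zk z : P z -> height beta (f1 eta z) <= height beta (zj eta k).
Proof.
move=> Pz; have [j [/andP[_ jk] j_angle j_le]] := next_vertex_beta.
exact: f1_edge_of_supports_zj j_angle j_le Pz.
Qed.

Lemma f1_edge_w1 z : P z -> height (pi *+ 2) (f1 eta z) <= height (pi *+ 2) (wj eta 1).
Proof.
move=> Pz; have [j [/andP[_ jk] j_angle j_le]] := next_vertex_2pi.
exact: f1_edge_of_supports_zj j_angle j_le Pz.
Qed.

Lemma f1_edge_wj j z : (1 < j < k)%N -> P z ->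
  height (pi + j%:R * eta + pi - eta) (f1 eta z)
  <= height (pi + j%:R * eta + pi - eta) (wj eta j).
Proof.
move=> /andP[j1 jk] Pz; rewrite -(f2_zj eta j).
apply: (@f1_edge_of_supports_wj _ j) => //.
- by rewrite j1 ltnW.
- by rewrite !edge_angle_zj ?(ltnW jk) // -natr1; have := eta_bd; lra.
- by have := @edge_angle_sin_le0 j.+1 (leqW jk); rewrite edge_angle_zj // -natr1 addrK.
- by rewrite (directed_height (directed_zj eta_bd j)).
Qed.

Lemma f1_edge_wk z : P z ->
  height (beta + pi - eta) (f1 eta z) <= height (beta + pi - eta) (wj eta k).
Proof.
move=> Pz; have [j [jk j_angle j_le]] := next_vertex_beta.
rewrite -(f2_zj eta k); apply: f1_edge_of_supports_wj jk j_angle _ j_le Pz.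
by rewrite -edge_angle_zk edge_angle_sin_le0 /=.
Qed.

Lemma halfplanes_f1 z : P z -> P (f1 eta z).
Proof.
move=> Pz; apply: halfplanes_intro => [|j jk||i /andP[i1]].
- exact: f1_edge_b0.
- exact: f1_edge_zj.
- exact: f1_edge_zk.
rewrite leq_eqVlt => /predU1P[->|].
  by rewrite edge_angle_zk nth_vertex_zj // f2_zj; exact: f1_edge_wk.
case: i i1 => // j; rewrite !ltnS leq_eqVlt => /predU1P[<-|j1] jk.
  rewrite edge_angle_zj ?nth_vertex_zj ?(ltnW jk) // f2_zj.
  rewrite (_ : _ + pi - eta = pi *+ 2); last by ring.
  exact: f1_edge_w1.
rewrite edge_angle_zj ?nth_vertex_zj ?(ltnW jk) // -natr1 addrK f2_zj.
by apply: f1_edge_wj; rewrite ?j1.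
Qed.

Lemma supports_z0 t : pi - eta <= t <= pi -> supports P t (zj eta 0).
Proof.
move=> ht; apply: supports_zj => //.
by rewrite !edge_angle_zj ?(leq_trans _ k_ge4) //; lra.
Qed.

Lemma supports_z1 t : pi <= t <= pi + eta -> supports P t (zj eta 1).
Proof.
move=> ht; apply: supports_zj; first exact: leq_trans k_ge4.
by rewrite !edge_angle_zj ?(leq_trans _ k_ge4) //; lra.
Qed.

Lemma f2_edge_of_supports j x z : supports P ((j%:R + 1) * eta) x ->
  height (pi + j%:R * eta) (f2 eta x) <= height (pi + j%:R * eta) (zj eta j) ->
  P z -> height (pi + j%:R * eta) (f2 eta z) <= height (pi + j%:R * eta) (zj eta j).
Proof.
move=> Px + Pz; apply: le_trans; have := height_f2_le eta_bd (Px z Pz).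
by rewrite (_ : _ + pi - eta = pi + j%:R * eta); last by ring.
Qed.

Lemma f2_edge_zj_low j z : (j.+2 < k)%N -> P z ->
  height (pi + j%:R * eta) (f2 eta z) <= height (pi + j%:R * eta) (zj eta j).
Proof.
move=> jk; apply: (@f2_edge_of_supports j (wj eta j.+2)).
  have vE : v (k + j.+3) = wj eta j.+2 by rewrite -addSnnS nth_vertex_wj ?(ltnW jk).
  have angleE : edge_angle (k + j.+3) = (j%:R + 1) * eta + pi *+ 2.
    by rewrite edge_angleDk /= ?edge_angle_zj ?leqW // -!natr1; ring.
  by apply/supportsD2pi; rewrite -angleE -vE; apply: supports_edge; lia.
exact: height_f2wj_le_zj jk.
Qed.

Lemma f2_edge_zj_penultimate j z : j.+2 = k -> P z ->
  height (pi + j%:R * eta) (f2 eta z) <= height (pi + j%:R * eta) (zj eta j).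
Proof.
move=> jk Pz; have jE : j%:R + 1 = M - 1 by rewrite -jk -!natr1; ring.
have ub := window_ub W; have beta_c := beta_closed.
have [Meta|Meta] := leP (M * eta) pi.
  apply: (@f2_edge_of_supports j (bj eta 0)) Pz; last exact: height_f2b0_le_zj jk Meta.
  by apply/supportsD2pi/supports_b0; rewrite jE; lra.
apply: (@f2_edge_of_supports j (zj eta 0)) Pz.
  by apply: supports_z0; rewrite jE; lra.
rewrite f2_zj; apply: (height_w0_le_zj W); first by rewrite -jk.
by case: (window_quarter_or4 W) => [|k4]; [left|right; move: jk; rewrite k4 => -[]].
Qed.

Lemma f2_edge_zj_last j z : j.+1 = k -> P z ->
  height (pi + j%:R * eta) (f2 eta z) <= height (pi + j%:R * eta) (zj eta j).
Proof.
move=> jk Pz; have jE : j%:R + 1 = M by rewrite -jk natr1.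
have jk_lt : (j < k)%N by rewrite jk.
have lb := window_lb W; have ub := window_ub W.
have [Meta|Meta] := leP (M * eta) pi.
  apply: (@f2_edge_of_supports j (zj eta 0)) Pz.
    by apply: supports_z0; rewrite jE; lra.
  rewrite f2_zj; apply: (height_w0_le_zj W) => //.
  by left; exact: window_quarter Meta.
apply: (@f2_edge_of_supports j (zj eta 1)) Pz.
  by apply: supports_z1; rewrite jE; lra.
rewrite f2_zj; apply: supports_zj halfplanes_w1; first exact: ltnW.
by rewrite !edge_angle_zj ?(ltnW jk_lt) // -?natr1; lra.
Qed.

Lemma f2_edge_zj j z : (j < k)%N -> P z ->
  height (pi + j%:R * eta) (f2 eta z) <= height (pi + j%:R * eta) (zj eta j).
Proof.
rewrite leq_eqVlt => /predU1P[|]; first exact: f2_edge_zj_last.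
rewrite leq_eqVlt => /predU1P[|]; first exact: f2_edge_zj_penultimate.
exact: f2_edge_zj_low.
Qed.

Lemma f2_edge_b0 z : P z ->
  height (pi - eta) (f2 eta z) <= height (pi - eta) (bj eta 0).
Proof.
move=> Pz; rewrite -(f2_w1 eta_bd) -!(heightD2pi (pi - eta)).
rewrite (_ : pi - eta + pi *+ 2 = pi *+ 2 + pi - eta); last by ring.
by apply: height_f2_le => //; apply: supports_w1 Pz; have := beta_open; lra.
Qed.

Lemma f2_edge_zk z : P z -> height beta (f2 eta z) <= height beta (zj eta k).
Proof.
move=> Pz; rewrite (directed_height beta_edge) -f2_zj.
rewrite (_ : beta = beta + eta - pi + pi - eta); last by ring.
apply: height_f2_le => //; apply: supports_z1 Pz.
by have := beta_closed; have := beta_open; lra.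
Qed.

Lemma halfplanes_f2 z : P z -> P (f2 eta z).
Proof.
move=> Pz; apply: halfplanes_intro => [|j jk||i ik].
- exact: f2_edge_b0.
- exact: f2_edge_zj.
- exact: f2_edge_zk.
- by apply: height_f2_le => //; apply: supports_edge Pz; lia.
Qed.

End Polygon.

(** * The attractor *)

Lemma closed_homothety_center (R : realType) (V : normedModType R) (K : set V)
    (z : V) (q : R) : `|q| < 1 -> closed K -> K !=set0 ->
  (forall x, K x -> K (z + q *: (x - z))) -> K z.
Proof.
move=> q1 clK [x0 Kx0] homK; pose u n := z + q ^+ n *: (x0 - z).
have Ku : \forall n \near \oo, K (u n).
  apply: nearW; elim=> [|n /homK]; first by rewrite /u expr0 scale1r addrC subrK.
  by rewrite /u addrAC subrr add0r scalerA -exprS.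
apply: (closed_cvg K clK Ku).
rewrite /u -[X in _ --> X]addr0 -(scale0r (x0 - z)).
by apply: cvgD; [exact: cvg_cst|apply: cvgZr_tmp; exact: cvg_expr].
Qed.

Section Attractor.
Context {R : realType}.
Variables (eta : R) (K : set (R * R)%type).
Hypothesis eta_bd : 0 < eta < pi / 3.
Hypothesis K_compact : compact K.
Hypothesis K_eq : K = (f1 eta @` K) `|` (f2 eta @` K).
Local Notation r := (absa eta).

Lemma bounded_height_diff p : exists B : R, forall t z, K z -> height t (z - p) <= B.
Proof.
have [m [_ Km]] := compact_bounded K_compact.
exists (2 * (m + 1 + `|p|)) => t z Kz.
have z_le : `|z| <= m + 1 by apply: Km Kz; rewrite ltrDl.
apply: le_trans (height_le_norm t _) _; rewrite ler_pM2l //.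
by apply: le_trans (ler_normB _ _) _; rewrite lerD2r.
Qed.

Section InvariantSet.
Variable P : set (R * R)%type.
Hypothesis P_f1 : forall z, P z -> P (f1 eta z).
Hypothesis P_f2 : forall z, P z -> P (f2 eta z).

(* A point of [K] is the image under n maps of another one; apply the same maps
   to [p]. *)
Lemma attractor_approx p B : P p -> (forall t z, K z -> height t (z - p) <= B) ->
  forall n z, K z -> exists2 q, P q & forall t, height t (z - q) <= r ^+ n * B.
Proof.
move=> Pp KB; have r0 := absa_gt0 eta_bd.
elim=> [|n IH] z Kz; first by exists p => // t; rewrite mul1r; exact: KB.
move: Kz; rewrite K_eq => -[] [x /IH[q Pq xq] <-].
  exists (f1 eta q) => [|t]; first exact: P_f1.
  by rewrite heightB !height_f1 -mulrBr -heightB exprS -mulrA ler_pM2l.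
exists (f2 eta q) => [|t]; first exact: P_f2.
have := xq (t + eta + pi); rewrite heightDpi heightB => xq_t.
by rewrite heightB !height_f2 exprS -mulrA -(ler_pM2l r0) in xq_t *; lra.
Qed.

Lemma attractor_supports t x : P !=set0 -> supports P t x -> supports K t x.
Proof.
move=> [p Pp] Px z Kz; have [B KB] := bounded_height_diff p.
rewrite -subr_le0.
have approx n : height t z - height t x <= r ^+ n * B.
  have [q Pq zq] := attractor_approx Pp KB n Kz.
  by have := zq t; have := Px q Pq; rewrite heightB; lra.
have rB_cvg : (fun n => r ^+ n * B) @ \oo --> 0 * B.
  apply: cvgMr_tmp; apply: cvg_expr; rewrite ger0_norm; first exact: absa_lt1.
  exact/ltW/absa_gt0.
rewrite -(mul0r B).
exact: ler_cvg_to (cvg_cst _) rB_cvg (nearW _ approx).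
Qed.

End InvariantSet.

Lemma attractor_f1 z : K z -> K (f1 eta z).
Proof. by move=> Kz; rewrite K_eq; left; exists z. Qed.

Lemma attractor_f2 z : K z -> K (f2 eta z).
Proof. by move=> Kz; rewrite K_eq; right; exists z. Qed.

Lemma attractor_z0 : K !=set0 -> K (zj eta 0).
Proof.
move=> K0; apply: (@closed_homothety_center _ _ K _ (r ^+ 4)) K0 _.
- by rewrite gtr0_norm ?absaX_gt0 // absaX_lt1.
- by apply: compact_closed => //; exact: norm_hausdorff.
- move=> z Kz; rewrite -f2f2f1f1E //.
  by do 2 apply: attractor_f2; do 2 apply: attractor_f1.
Qed.

Lemma attractor_vertices k : K !=set0 -> [set x | x \in vertex_list eta k] `<=` K.
Proof.
move=> K0; have Kz j : K (zj eta j).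
  by elim: j => [|j IH]; [exact: attractor_z0|rewrite -f1_zj; exact: attractor_f1].
have Kw j : K (wj eta j) by rewrite -f2_zj; exact: attractor_f2.
move=> x /=; rewrite inE mem_cat => /or3P[/eqP->|/mapP[j _ ->]|/mapP[j _ ->]] //.
by rewrite -f2_w1 //; exact: attractor_f2.
Qed.

End Attractor.

Theorem theorem1p3 (R : realType) (k : nat) (eta eta_k1 eta_k : R)
  (K : set (R * R)%type) :
  (4 <= k)%N ->
  (* eta_{k+1}: the (unique) zero of Phi_{k+1} in (pi/(k+1), pi/k) *)
  pi / k.+1%:R < eta_k1 < pi / k%:R -> Phi k.+1 eta_k1 = 0 ->
  (* eta_k: the (unique) zero of Phi_k in (pi/k, pi/(k-1)) *)
  pi / k%:R < eta_k < pi / (k%:R - 1) -> Phi k eta_k = 0 ->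
  eta_k1 <= eta < eta_k ->
  0 < eta < pi / 3 ->
  (* K = K_eta: nonempty compact with K = f1(K) u f2(K) *)
  K !=set0 -> compact K -> K = (f1 eta @` K) `|` (f2 eta @` K) ->
  polygon_cw (conv_hull K) (vertex_list eta k).
Proof.
move=> k4 zero_k1_bd zero_k1 zero_k_bd zero_k eta_range eta_bd K0 K_compact K_eq.
have W := Phi_zeros_window k4 zero_k1_bd zero_k1 zero_k_bd zero_k eta_range.
have [beta [beta_open beta_closed beta_edge]] := directed_zkw1 W.
have cw := clockwise_vertex_list W beta_open beta_closed beta_edge.
suff -> : conv_hull K = halfplanes (vertex_list eta k) (edge_angle k eta beta).
  exact: clockwise_polygon cw.
apply/seteqP; split.
  apply: conv_hull_sub; first exact: halfplanes_convex.
  move=> z Kz i i_lt; apply: (attractor_supports eta_bd K_compact K_eq _ _ _) Kz.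
  - exact: halfplanes_f1 W beta_open beta_closed beta_edge.
  - exact: halfplanes_f2 W beta_open beta_closed beta_edge.
  - by exists (wj eta 1); exact: halfplanes_w1 W beta_open beta_closed beta_edge.
  - exact: halfplanes_supports.
rewrite (halfplanes_conv_hull cw); apply: conv_hull_sub; first exact: conv_hull_convex.
by apply: subset_trans (@sub_conv_hull _ _); exact: attractor_vertices.
Qed.
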